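(* Let $g=(g_{ij}(x))$ be a smooth symmetric bilinear form (possibly degenerate, of any signature) of constant rank on a domain $U\subset\mathbb{R}^n$, and assume that at every $x\in U$ $$\sum_s\Gamma_{ij,s}v^s=0\quad\text{for all } i,j \text{ and every } v\in\mathcal{R}_g(x).$$ For smooth functions $\Gamma^i_{jk}$ with $\Gamma^i_{jk}=\Gamma^i_{kj}$ satisfying $$\sum_s\left(\Gamma^s_{jk}g_{is}+\Gamma^s_{ik}g_{js}\right)=\frac{\partial g_{ij}}{\partial x^k}\quad\text{for all } i,j,k, \qquad (\ast)$$ put $$R_{ijk\ell}:=\sum_s g_{is}\left(\frac{\partial \Gamma^s_{j\ell}}{\partial x^k}-\frac{\partial\Gamma^s_{jk}}{\partial x^\ell}+\sum_a\left(\Gamma^s_{ka}\Gamma^a_{\ell j}-\Gamma^s_{\ell a}\Gamma^a_{jk}\right)\right).$$ Then the functions $R_{ijk\ell}$ do not depend on the choice of the smooth functions $\Gamma^i_{jk}=\Gamma^i_{kj}$ satisfying $(\ast)$. Moreover, flat coordinates for $g$ exist (in a neighbourhood of every point of $U$) if and only if there exist smooth functions $\Gamma^i_{jk}=\Gamma^i_{kj}$ satisfying $(\ast)$ such that $R_{ijk\ell}=0$ for all $i,j,k,\ell$.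
   Context: All indices run from $1$ to $n$. Notation: $\Gamma_{ij,s}:=\tfrac12\left(\frac{\partial g_{js}}{\partial x^i}+\frac{\partial g_{is}}{\partial x^j}-\frac{\partial g_{ij}}{\partial x^s}\right)$ and $\mathcal{R}_g(x):=\{v\in T_xU\mid g(v,\cdot)=0\}$. The form $g$ is a covariant tensor field: in another coordinate system $y^1,\dots,y^n$ its components are $\sum_{r,s}g_{rs}\frac{\partial x^r}{\partial y^i}\frac{\partial x^s}{\partial y^j}$. A local coordinate system is called flat for $g$ if the components of $g$ in it are constant. (At a given point, the freedom in the solutions $\Gamma^i_{jk}$ of $(\ast)$ is the addition of sums of terms $v^iT_{jk}$ with $v\in\mathcal{R}_g$ and $T_{jk}=T_{kj}$.) *)

(* Defs.v *)
From HB Require Import structures.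
From mathcomp Require Import all_boot all_order all_algebra.
From mathcomp Require Import all_classical all_reals all_analysis.
Set Implicit Arguments.
Unset Strict Implicit.
Unset Printing Implicit Defensive.
Import Order.TTheory GRing.Theory Num.Theory.
Import numFieldNormedType.Exports.
Local Open Scope classical_set_scope.
Local Open Scope ring_scope.

(* Functions on an open set U of R^n are represented by total functions on
   'rV[R]_n; only their values on U matter. *)

Section DegenerateMetric.
Context {R : realType} {n : nat}.
Implicit Types (U V : set 'rV[R]_n) (g : 'rV[R]_n -> 'M[R]_n).

Definition domain U := [/\ open U, connected U & U !=set0].

Definition partial (i : 'I_n) (f : 'rV[R]_n -> R) (x : 'rV[R]_n) : R :=
  'D_(delta_mx 0 i) f x.

(* C^oo on the open set U: all iterated partial derivatives exist and are
   continuous at every point of U. *)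
Definition smooth U (f : 'rV[R]_n -> R) :=
  forall (s : seq 'I_n) (x : 'rV[R]_n), U x ->
    {for x, continuous (foldr partial f s)} /\
    forall i, derivable (foldr partial f s) x (delta_mx 0 i).

Definition smooth_map U (f : 'rV[R]_n -> 'rV[R]_n) :=
  forall i, smooth U (fun x => f x 0 i).

Definition smooth_symmetric_form U g :=
  (forall i j, smooth U (fun x => g x i j)) /\
  (forall x, U x -> forall i j, g x i j = g x j i).

Definition constant_rank U g :=
  exists r : nat, forall x, U x -> \rank (g x) = r.

(* v *m g x is the row of components of the covector g(v, -) at x. *)
Definition radical g (x : 'rV[R]_n) : set 'rV[R]_n :=
  [set v | v *m g x = 0].

(* Gamma_{ij,s} *)
Definition Gamma_low g (i j s : 'I_n) (x : 'rV[R]_n) : R :=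
  2^-1 * (partial i (fun z => g z j s) x + partial j (fun z => g z i s) x
          - partial s (fun z => g z i j) x).

(* Gam i j k stands for Gamma^i_{jk}. *)
Definition Gamma_solution U g (Gam : 'I_n -> 'I_n -> 'I_n -> 'rV[R]_n -> R) :=
  [/\ forall i j k, smooth U (Gam i j k),
      forall i j k x, U x -> Gam i j k x = Gam i k j x
    & forall i j k x, U x ->
        \sum_s (Gam s j k x * g x i s + Gam s i k x * g x j s)
        = partial k (fun z => g z i j) x].

(* R_{ijkl} *)
Definition Rtensor g (Gam : 'I_n -> 'I_n -> 'I_n -> 'rV[R]_n -> R)
    (i j k l : 'I_n) (x : 'rV[R]_n) : R :=
  \sum_s g x i s *
    (partial k (Gam s j l) x - partial l (Gam s j k) x
     + \sum_a (Gam s k a x * Gam a l j x - Gam s l a x * Gam a j k x)).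

(* y = (y^1, .., y^n) is a coordinate system on V with inverse
   x = (x^1(y), .., x^n(y)) on its (open) image. *)
Definition coordinates V (y x : 'rV[R]_n -> 'rV[R]_n) :=
  [/\ open V, open (y @` V), smooth_map V y, smooth_map (y @` V) x
    & {in V, cancel y x}].

Definition component g (x : 'rV[R]_n -> 'rV[R]_n) (i j : 'I_n)
    (q : 'rV[R]_n) : R :=
  \sum_r \sum_s g (x q) r s * partial i (fun z => x z 0 r) q
                            * partial j (fun z => x z 0 s) q.

Definition flat g V (y x : 'rV[R]_n -> 'rV[R]_n) :=
  coordinates V y x /\
  exists c : 'I_n -> 'I_n -> R,
    forall i j q, (y @` V) q -> component g x i j q = c i j.

Definition flat_coordinates_exist U g :=
  forall p, U p -> exists (V : set 'rV[R]_n) (y x : 'rV[R]_n -> 'rV[R]_n),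
    [/\ V p, V `<=` U & flat g V y x].

End DegenerateMetric.

(* Main.v *)
(* A smooth solution of the linear equation for the Christoffel symbols is a
   torsion-free connection preserving [g]; contracting its curvature with [g]
   and integrating by parts leaves an expression in which the connection only
   enters through [g(Gamma_ik, Gamma_jl)], hence the independence.

   If flat coordinates exist, the Moore-Penrose solution, smooth because the
   rank is constant, is a global connection, and its tensor [R] can be computed
   locally with the connection that is trivial in the flat coordinates.

   Conversely, [R = 0] says that the curvature takes values in the radical, so
   the induced connection on the bundle of covectors vanishing on the radical is
   flat.  Its parallel sections (obtained by Picard iteration along the rays
   through a point) are closed by the symmetry of the connection; [g] has
   constant coefficients in a parallel coframe, and the potentials, completed by
   linear functions, are flat coordinates by the inverse function theorem. *)
Require Import Defs.
From mathcomp Require Import all_boot all_order all_algebra.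
From mathcomp Require Import all_classical all_reals all_analysis.
From mathcomp Require Import ring lra.
Set Implicit Arguments.
Unset Strict Implicit.
Unset Printing Implicit Defensive.
Import Order.TTheory GRing.Theory Num.Theory.
Import numFieldNormedType.Exports.
Local Open Scope classical_set_scope.
Local Open Scope ring_scope.

(** * Smooth functions *)

(** Smoothness is a condition on iterated partial derivatives only, so the analysis rests on mean
    values taken one coordinate at a time. Regularity of limits and inverses is gained by a
    bootstrap from first-order equations for their partial derivatives. The obstacle in the converse
    is that integration along rays controls only the radial equation. Increments and defects of the
    Picard iteration are therefore estimated together, on a ball so small that both halve at each
    step; then all partial derivatives converge and the limit solves the system in every direction.
    The indeterminacy [v^i T_jk] of the connection is invisible to covectors vanishing on the
    radical, and the rows of [g] span exactly these; hence the frames [S *m g] with [S] constant.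
    Constancy of the coefficients of [g] in a parallel coframe is a uniqueness statement: [g] and
    the form with the coefficients frozen at the centre satisfy the same linear system and agree
    there. The coordinates are normalised to have identity Jacobian matrix at the centre, so only
    perturbations of the identity have to be inverted. *)

Section RowNorm.
Context {R : realType} {n : nat}.
Implicit Types (x y p : 'rV[R]_n) (r : R).

Lemma rV_coord_le x i : `|x 0 i| <= `|x|.
Proof.
by rewrite [leRHS]/Num.Def.normr/= mx_normrE; exact: (le_bigmax _ _ (0, i)).
Qed.

Lemma rV_norm_le x r : 0 <= r -> (forall i, `|x 0 i| <= r) -> `|x| <= r.
Proof.
move=> r0 xr; rewrite [leLHS]/Num.Def.normr/= mx_normrE (bigmax_le _ r0)//=.
by move=> [i j] _ /=; rewrite (ord1 i).
Qed.

Lemma ball_rVE p r x : ball p r x = (`|x - p| < r) :> Prop.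
Proof. by rewrite -ball_normE /= distrC. Qed.

Lemma norm_delta_le i : `|delta_mx 0 i : 'rV[R]_n| <= 1.
Proof.
apply: rV_norm_le => // j; rewrite mxE eqxx /=.
by case: (j == i); rewrite ?normr1 ?normr0.
Qed.

Lemma ball_segment p r x (t : R) : ball p r x -> 0 <= t <= 1 ->
  ball p r (p + t *: (x - p)).
Proof.
rewrite !ball_rVE => xr /andP[t0 t1].
rewrite addrAC subrr add0r normrZ ger0_norm//.
by apply: le_lt_trans xr; rewrite ler_piMl.
Qed.

End RowNorm.

Section Smooth.
Context {R : realType} {n : nat}.
Implicit Types (U V : set 'rV[R]_n) (f h : 'rV[R]_n -> R) (x : 'rV[R]_n).

(* C^m on U, by recursion on the outermost derivative; [smooth] peels off the
   innermost one. *)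
Fixpoint Ck U (m : nat) f : Prop :=
  (forall x, U x -> {for x, continuous f}) /\
  if m is m'.+1 then
    forall i, (forall x, U x -> derivable f x (delta_mx 0 i)) /\
              Ck U m' (partial i f)
  else True.

Lemma smoothP U f : smooth U f <-> forall m, Ck U m f.
Proof.
split=> [+ m|].
  elim: m f => [|m IH] f sf; (split; first by move=> x Ux; exact: (sf [::] x Ux).1).
    by [].
  move=> i; split; first by move=> x Ux; exact: (sf [::] x Ux).2.
  by apply: IH => s x Ux; have := sf (rcons s i) x Ux; rewrite foldr_rcons.
move=> cf s x Ux; elim/last_ind: s f cf => [|s i IH] f cf.
  split; first exact: (cf 0%N).1.
  by move=> i; exact: ((cf 1%N).2 i).1.
by rewrite foldr_rcons; apply: IH => m; exact: ((cf m.+1).2 i).2.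
Qed.

Lemma smooth_continuous U f x : smooth U f -> U x -> {for x, continuous f}.
Proof. by move=> sf Ux; exact: (sf [::] x Ux).1. Qed.

Lemma smooth_derivable U f x i : smooth U f -> U x ->
  derivable f x (delta_mx 0 i).
Proof. by move=> sf Ux; exact: (sf [::] x Ux).2. Qed.

Lemma smooth_partial U f i : smooth U f -> smooth U (partial i f).
Proof. by move=> sf s x Ux; have := sf (rcons s i) x Ux; rewrite foldr_rcons. Qed.

Lemma smooth_sub U V f : V `<=` U -> smooth U f -> smooth V f.
Proof. by move=> VU sf s x /VU; exact: sf. Qed.

Lemma smooth_locally U f :
  (forall x, U x -> exists2 V, V x & smooth V f) -> smooth U f.
Proof. by move=> H s x /H[V Vx]; exact. Qed.

Lemma near_eqU U f h x : open U -> U x -> {in U, f =1 h} -> {near x, f =1 h}.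
Proof.
move=> oU Ux fh; near=> y; apply: fh; rewrite inE.
by near: y; exact: open_nbhs_nbhs.
Unshelve. all: by end_near. Qed.

Lemma eq_partial U f h x i : open U -> U x -> {in U, f =1 h} ->
  partial i f x = partial i h x.
Proof. by move=> oU Ux fh; apply: near_eq_derive; exact: near_eqU fh. Qed.

Lemma eq_continuous U f h x : open U -> U x -> {in U, f =1 h} ->
  {for x, continuous f} -> {for x, continuous h}.
Proof.
move=> oU Ux fh cf.
rewrite /prop_for /continuous_at -(fh x) ?inE//.
have hf : {near x, f =1 h} by exact: near_eqU fh.
apply: cvg_trans cf; exact: (near_eq_cvg hf).
Qed.

Lemma eq_Ck U m f h : open U -> {in U, f =1 h} -> Ck U m f -> Ck U m h.
Proof.
move=> oU; elim: m f h => [|m IH] f h fh [cf df];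
  (split; first by move=> x Ux; exact: (eq_continuous oU Ux fh (cf x Ux))).
  by [].
move=> i; split.
  move=> x Ux; apply: near_eq_derivable ((df i).1 x Ux).
  exact: (near_eqU oU Ux fh).
apply: (IH _ _ _ (df i).2) => x /set_mem Ux; exact: (eq_partial i oU Ux fh).
Qed.

Lemma eq_smooth U f h : open U -> {in U, f =1 h} -> smooth U f -> smooth U h.
Proof.
by move=> oU fh /smoothP sf; apply/smoothP => m; exact: eq_Ck (sf m).
Qed.

Lemma CkW U m f : Ck U m.+1 f -> Ck U m f.
Proof.
elim: m f => [|m IH] f [cf df]; split=> // i; split; first exact: (df i).1.
by apply: IH; exact: (df i).2.
Qed.

Lemma Ck_cst U m (c : R) : Ck U m (fun=> c).
Proof.
elim: m c => [|m IH] c; (split; first by move=> x _; exact: cst_continuous) => // i.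
split; first by move=> x _; exact: derivable_cst.
rewrite (_ : partial i _ = fun=> 0)//.
by apply/funext => x; exact: derive_cst.
Qed.

Lemma smooth_cst U (c : R) : smooth U (fun=> c).
Proof. by apply/smoothP => m; exact: Ck_cst. Qed.
Arguments smooth_cst : clear implicits.
Arguments Ck_cst : clear implicits.

Lemma CkD U m f h : open U -> Ck U m f -> Ck U m h -> Ck U m (fun x => f x + h x).
Proof.
move=> oU; elim: m f h => [|m IH] f h [cf df] [ch dh];
  (split; first by move=> x Ux; exact: (cvgD (cf x Ux) (ch x Ux))) => // i.
split; first by move=> x Ux; exact: (derivableD ((df i).1 x Ux) ((dh i).1 x Ux)).
apply: eq_Ck (IH _ _ (df i).2 (dh i).2) => // x /set_mem Ux.
by rewrite /partial (deriveD ((df i).1 x Ux) ((dh i).1 x Ux)).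
Qed.

Lemma CkM U m f h : open U -> Ck U m f -> Ck U m h -> Ck U m (fun x => f x * h x).
Proof.
move=> oU; elim: m f h => [|m IH] f h cf ch.
  by split=> // x Ux; exact: (cvgM (cf.1 x Ux) (ch.1 x Ux)).
split; first by move=> x Ux; exact: (cvgM (cf.1 x Ux) (ch.1 x Ux)).
move=> i; split.
  by move=> x Ux; exact: (derivableM ((cf.2 i).1 x Ux) ((ch.2 i).1 x Ux)).
have H := CkD oU (IH _ _ (CkW cf) (ch.2 i).2) (IH _ _ (CkW ch) (cf.2 i).2).
apply: eq_Ck H => // x /set_mem Ux.
by rewrite /partial (deriveM ((cf.2 i).1 x Ux) ((ch.2 i).1 x Ux)).
Qed.

Lemma Ck_sum U m (I : Type) (s : seq I) (P : pred I) (F : I -> 'rV[R]_n -> R) :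
  open U -> (forall i, P i -> Ck U m (F i)) ->
  Ck U m (fun x => \sum_(i <- s | P i) F i x).
Proof.
move=> oU sF; elim: s => [|i s IH].
  by apply: (eq_Ck oU _ (Ck_cst U m 0)) => x _; rewrite big_nil.
case Pi : (P i); last first.
  by apply: (eq_Ck oU _ IH) => x _; rewrite big_cons Pi.
by apply: (eq_Ck oU _ (CkD oU (sF i Pi) IH)) => x _; rewrite big_cons Pi.
Qed.

Lemma smooth_sum U (I : Type) (s : seq I) (P : pred I) (F : I -> 'rV[R]_n -> R) :
  open U -> (forall i, P i -> smooth U (F i)) ->
  smooth U (fun x => \sum_(i <- s | P i) F i x).
Proof.
move=> oU sF; apply/smoothP => m; apply: Ck_sum => // i Pi.
by have /smoothP := sF i Pi.
Qed.

Lemma smoothD U f h : open U -> smooth U f -> smooth U h ->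
  smooth U (fun x => f x + h x).
Proof. by move=> oU /smoothP sf /smoothP sh; apply/smoothP => m; exact: CkD. Qed.

Lemma smoothM U f h : open U -> smooth U f -> smooth U h ->
  smooth U (fun x => f x * h x).
Proof. by move=> oU /smoothP sf /smoothP sh; apply/smoothP => m; exact: CkM. Qed.

Lemma smoothN U f : open U -> smooth U f -> smooth U (fun x => - f x).
Proof.
move=> oU sf; refine (eq_smooth oU _ (smoothM oU (smooth_cst U (-1)) sf)) => x _.
by rewrite mulN1r.
Qed.

Lemma smoothB U f h : open U -> smooth U f -> smooth U h ->
  smooth U (fun x => f x - h x).
Proof. by move=> oU sf sh; apply: smoothD => //; exact: smoothN. Qed.

Lemma smooth_prod U (I : Type) (s : seq I) (P : pred I) (F : I -> 'rV[R]_n -> R) :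
  open U -> (forall i, P i -> smooth U (F i)) ->
  smooth U (fun x => \prod_(i <- s | P i) F i x).
Proof.
move=> oU sF; elim: s => [|i s IH].
  by refine (eq_smooth oU _ (smooth_cst U 1)) => x _; rewrite big_nil.
case Pi : (P i); last first.
  by refine (eq_smooth oU _ IH) => x _; rewrite big_cons Pi.
by refine (eq_smooth oU _ (smoothM oU (sF i Pi) IH)) => x _; rewrite big_cons Pi.
Qed.

Lemma smoothV U f : open U -> (forall x, U x -> f x != 0) -> smooth U f ->
  smooth U (fun x => (f x)^-1).
Proof.
move=> oU f0 /smoothP sf; apply/smoothP; elim=> [|m IH].
  by split=> // x Ux; exact: (cvgV (f0 x Ux) ((sf 0%N).1 x Ux)).
split; first by move=> x Ux; exact: (cvgV (f0 x Ux) ((sf 0%N).1 x Ux)).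
move=> i; split.
  by move=> x Ux; exact: (derivableV (f0 x Ux) (((sf 1%N).2 i).1 x Ux)).
have H := CkM oU (Ck_cst U m (-1))
  (CkM oU (CkM oU IH IH) ((sf m.+1).2 i).2).
apply: eq_Ck H => // x /set_mem Ux.
rewrite /partial (deriveV (f0 x Ux) (((sf 1%N).2 i).1 x Ux)).
by rewrite mulN1r scaleNr expr2 invfM.
Qed.

Lemma derive_coord (v x : 'rV[R]_n) j : 'D_v (fun z : 'rV[R]_n => z 0 j) x = v 0 j.
Proof.
have := derive_mx (@derivable_id R 'rV[R]_n x v).
by rewrite derive_id => /rowP/(_ j); rewrite !mxE.
Qed.

Lemma partial_coord (i j : 'I_n) x :
  partial i (fun z : 'rV[R]_n => z 0 j) x = (i == j)%:R.
Proof. by rewrite /partial derive_coord mxE eqxx eq_sym. Qed.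

Lemma smooth_coord U j : smooth U (fun z : 'rV[R]_n => z 0 j).
Proof.
apply/smoothP => -[|m].
  by split=> // x _; exact: coord_continuous.
split; first by move=> x _; exact: coord_continuous.
move=> i; split.
  by move=> x _; have /derivable_mxP := @derivable_id R 'rV[R]_n x (delta_mx 0 i).
rewrite (_ : partial i _ = fun=> (i == j)%:R); first exact: Ck_cst.
by apply/funext => x; rewrite partial_coord.
Qed.

End Smooth.
Arguments smooth_cst {R n} U c.
Arguments Ck_cst {R n} U m c.

(** * Mean values and the chain rule *)

Section OneVariable.
Context {R : realType}.

Let ratio01 (c d : R) : 0 < d -> 0 <= c <= d -> 0 <= c / d <= 1.
Proof.
by move=> d0 /andP[c0 cd]; rewrite divr_ge0//= ?(ltW d0)// ler_pdivrMr// mul1r.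
Qed.

Let ratioN01 (c d : R) : d < 0 -> d <= c <= 0 -> 0 <= c / d <= 1.
Proof.
move=> d0 /andP[dc c0]; rewrite -mulrNN -invrN; apply: ratio01.
  by rewrite oppr_gt0.
by rewrite oppr_ge0 c0 lerN2.
Qed.

(** Parametrising the segment from [0] to [d] by [tau * d] with [tau] in the unit interval gives one
    statement for both signs of [d]. *)
Lemma mean_value1 (phi dphi : R -> R) (d : R) :
  (forall tau : R, 0 <= tau <= 1 ->
     is_derive (tau * d) 1 phi (dphi (tau * d))) ->
  exists2 tau, 0 <= tau <= 1 & phi d - phi 0 = dphi (tau * d) * d.
Proof.
move=> dp.
have dp' c tau : 0 <= tau <= 1 -> c = tau * d -> is_derive c 1 phi (dphi c).
  by move=> t01 ->; exact: dp.
have [d0|d0|d0] := ltrgtP d 0; last first.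
- by exists 0; rewrite ?lexx ?ler01// d0 subrr mulr0.
- have dc c : 0 <= c <= d -> is_derive c 1 phi (dphi c).
    by move=> cd; apply: (dp' _ (c / d)); rewrite ?ratio01// divfK ?gt_eqF.
  have [||c] := @MVT_segment R phi dphi 0 d (ltW d0).
  + by move=> c /[!in_itv]/= /andP[c0 cd]; apply: dc; rewrite !ltW.
  + apply: derivable_within_continuous => c /[!in_itv]/= cd.
    by have [] := dc c cd.
  rewrite in_itv/= => cd E; exists (c / d); first exact: ratio01.
  by rewrite divfK ?gt_eqF// E subr0.
have dc c : d <= c <= 0 -> is_derive c 1 phi (dphi c).
  by move=> cd; apply: (dp' _ (c / d)); rewrite ?ratioN01// divfK ?lt_eqF.
have [||c] := @MVT_segment R phi dphi d 0 (ltW d0).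
- by move=> c /[!in_itv]/= /andP[c0 cd]; apply: dc; rewrite !ltW.
- apply: derivable_within_continuous => c /[!in_itv]/= cd.
  by have [] := dc c cd.
rewrite in_itv/= => cd E; exists (c / d); first exact: ratioN01.
by rewrite divfK ?lt_eqF//; apply: oppr_inj; rewrite opprB E sub0r mulrN.
Qed.

End OneVariable.

Section Differential.
Context {R : realType} {n : nat}.
Implicit Types (U V : set 'rV[R]_n) (f : 'rV[R]_n -> R) (x y p : 'rV[R]_n).

Lemma is_derive_line f (a v : 'rV[R]_n) (t : R) :
  derivable f (a + t *: v) v ->
  is_derive t 1 (fun s => f (a + s *: v)) ('D_v f (a + t *: v)).
Proof.
rewrite /derivable /derive => df.
set g1 := fun h => h^-1 *: _ in df *.
have E : (fun h : R => h^-1 *: ((fun s => f (a + s *: v)) (h *: 1 + t) - f (a + t *: v))) = g1.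
  apply/funext => h; rewrite /g1 /=; congr (_ *: (f _ - _)).
  by rewrite scalerDl [_%:A]mulr1 addrCA.
by apply: DeriveDef; rewrite /derivable /derive E.
Qed.

(** The path from [x] to [y] changes one coordinate at a time, with one mean value per coordinate.
    Balls of the sup norm are boxes, so the whole path stays in the ball, no farther from [x] than
    [y] is. *)
Lemma mean_rV (p : 'rV[R]_n) (r : R) f x y :
  (forall i z, ball p r z -> derivable f z (delta_mx 0 i)) ->
  ball p r x -> ball p r y ->
  exists z : 'I_n -> 'rV[R]_n,
    (forall i, ball p r (z i) /\ `|z i - x| <= `|y - x|) /\
    f y - f x = \sum_i partial i f (z i) * (y 0 i - x 0 i).
Proof.
move=> df px py.
pose w (k : nat) : 'rV[R]_n := \row_j (if (j < k)%N then y 0 j else x 0 j).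
have box (z : 'rV[R]_n) : (forall j, exists2 t : R, 0 <= t <= 1 & z 0 j = x 0 j + t * (y 0 j - x 0 j)) ->
    ball p r z /\ `|z - x| <= `|y - x|.
  move=> zt; split; last first.
    apply: rV_norm_le => // j; have [t /andP[t0 t1] zj] := zt j.
    rewrite !mxE zj addrAC subrr add0r normrM ger0_norm//.
    apply: (@le_trans _ _ `|(y - x) 0 j|); last exact: rV_coord_le.
    by rewrite !mxE ler_piMl.
  have xp : `|x - p| < r by rewrite -ball_rVE.
  have yp : `|y - p| < r by rewrite -ball_rVE.
  have rm : Num.max `|x - p| `|y - p| < r by rewrite gt_max xp.
  rewrite ball_rVE; apply: le_lt_trans rm.
  apply: rV_norm_le; first by rewrite le_max normr_ge0.
  move=> j; have [t /andP[t0 t1] zj] := zt j.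
  have -> : (z - p) 0 j = (1 - t) * (x - p) 0 j + t * (y - p) 0 j.
    by rewrite !mxE zj; ring.
  apply: (le_trans (ler_normD _ _)); rewrite !normrM (ger0_norm t0).
  have t1' : 0 <= 1 - t by rewrite subr_ge0.
  rewrite (ger0_norm t1').
  set M := Num.max _ _.
  have hx : `|(x - p) 0 j| <= M by rewrite le_max rV_coord_le.
  have hy : `|(y - p) 0 j| <= M by rewrite le_max rV_coord_le orbT.
  have : (1 - t) * `|(x - p) 0 j| <= (1 - t) * M by rewrite ler_wpM2l.
  have : t * `|(y - p) 0 j| <= t * M by rewrite ler_wpM2l.
  lra.
have step (k : 'I_n) : exists z, (ball p r z /\ `|z - x| <= `|y - x|) /\
    f (w k.+1) - f (w k) = partial k f z * (y 0 k - x 0 k).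
  pose d := y 0 k - x 0 k.
  have wS : w k.+1 = w k + d *: delta_mx 0 k.
    apply/rowP => j; rewrite !mxE eqxx /= ltnS leq_eqVlt.
    have [->|jk] := eqVneq j k.
      by rewrite eqxx ltnn /= mulr1 /d addrC subrK.
    have -> : (j == k :> nat) = false by apply/negbTE.
    by rewrite /= mulr0 addr0.
  have bz (t : R) : 0 <= t <= 1 ->
      ball p r (w k + (t * d) *: delta_mx 0 k) /\
      `|w k + (t * d) *: delta_mx 0 k - x| <= `|y - x|.
    move=> t01; apply: box => j.
    rewrite !mxE eqxx /=; have [->|jk] := eqVneq j k.
      by exists t => //; rewrite ltnn mulr1.
    rewrite mulr0 addr0; case: ltnP => _.
      by exists 1; rewrite ?lexx ?ler01// mul1r addrC subrK.
    by exists 0; rewrite ?lexx ?ler01// mul0r addr0.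
  have [|t t01 E] := @mean_value1 R (fun s => f (w k + s *: delta_mx 0 k))
    (fun s => partial k f (w k + s *: delta_mx 0 k)) d.
    by move=> t t01; apply: is_derive_line; apply: df; exact: (bz t t01).1.
  exists (w k + (t * d) *: delta_mx 0 k); split; first exact: bz.
  by rewrite wS -[X in _ - f X = _](addr0) -(scale0r (delta_mx 0 k : 'rV[R]_n)).
have [z zP] := choice step.
exists z; split=> [i|]; first exact: (zP i).1.
transitivity (\sum_(i < n) (f (w i.+1) - f (w i))).
  rewrite -(big_mkord xpredT (fun i => f (w i.+1) - f (w i))) telescope_sumr//.
  by congr (f _ - f _); apply/rowP => j; rewrite mxE ?ltn_ord.
by apply: eq_bigr => i _; exact: (zP i).2.
Qed.

(** By [mean_rV] the difference quotient is a sum of partial derivatives at intermediate points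
    times difference quotients of the coordinates. The points tend to [c t], where the partial
    derivatives are continuous. *)
Lemma is_derive_curve U f (c : R -> 'rV[R]_n) (t : R) (dc : 'I_n -> R) :
  open U -> smooth U f -> U (c t) ->
  (forall i, is_derive t 1 (fun s => c s 0 i) (dc i)) ->
  is_derive t 1 (fun s => f (c s)) (\sum_i partial i f (c t) * dc i).
Proof.
move=> oU sf Uct cd.
have /nbhs_ballP[r /= r0 rU] : nbhs (c t) U by exact: open_nbhs_nbhs.
have cq i : (h^-1 * (c (h + t) 0 i - c t 0 i)) @[h --> 0^'] --> dc i.
  have [] := cd i; rewrite /derivable /derive => /cvg_ex[/= l lE] lv.
  have -> : dc i = l.
    by rewrite -lv; apply/cvg_lim.
  apply: cvg_trans lE; apply: near_eq_cvg; near=> h.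
  by rewrite [_%:A]mulr1.
have cc (e : R) : 0 < e -> \forall h \near 0^', `|c (h + t) - c t| < e.
  move=> e0.
  have H i : \forall h \near 0^', `|c (h + t) 0 i - c t 0 i| < e / 2.
    have ci : {for t, continuous (fun s => c s 0 i)}.
      apply/differentiable_continuous; rewrite -derivable1_diffP.
      by have [] := cd i.
    have : (c (h + t) 0 i) @[h --> 0^'] --> c t 0 i.
      apply: cvg_within_filter.
      have ht : (h + t) @[h --> (0 : R)] --> t.
        by rewrite -[X in _ --> X]add0r; apply: cvgD; [exact: cvg_id|exact: cvg_cst].
      exact: (cvg_comp _ _ ht ci).
    move/cvgrPdist_lt => /(_ (e / 2)); rewrite divr_gt0// => /(_ isT).
    by apply: filterS => h; rewrite distrC.
  near=> h; apply: (@le_lt_trans _ _ (e / 2)); last by rewrite ltr_pdivrMr// ltr_pMr// ltr1n.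
  apply: rV_norm_le; first by rewrite ltW// divr_gt0.
  move=> i; rewrite !mxE; apply: ltW; move: i; near: h.
  exact: filter_forall.
pose P h (z : 'I_n -> 'rV[R]_n) := (forall i, `|z i - c t| <= `|c (h + t) - c t|) /\
    f (c (h + t)) - f (c t) = \sum_i partial i f (z i) * (c (h + t) 0 i - c t 0 i).
(* The intermediate points depend on [h] and have to be selected; the default [c t] is irrelevant
   near [0], where suitable points exist. *)
pose Z h := xget (fun=> c t) (P h).
have ZP : \forall h \near 0^', P h (Z h).
  near=> h; rewrite /Z; apply: xgetPex.
  have [|||z [z1 z2]] := @mean_rV (c t) r f (c t) (c (h + t)).
  - by move=> i z bz; exact: smooth_derivable sf (rU _ bz).
  - exact: ballxx.
  - by rewrite ball_rVE; near: h; exact: cc.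
  by exists z; split=> // i; exact: (z1 i).2.
have L : (\sum_i partial i f (Z h i) * (h^-1 * (c (h + t) 0 i - c t 0 i)))
    @[h --> 0^'] --> \sum_i partial i f (c t) * dc i.
  apply: cvg_big; first exact: add_continuous.
  move=> i _ /=.
  apply: cvgM; last exact: cq.
  have pc : {for (c t), continuous (partial i f)}.
    exact: (smooth_continuous (smooth_partial i sf) Uct).
  apply: (@cvg_comp _ _ _ (fun h => Z h i) (partial i f) _ (nbhs (c t))); last exact: pc.
  apply/cvgrPdist_lt => e e0; near=> h; rewrite distrC.
  apply: (@le_lt_trans _ _ `|c (h + t) - c t|); last by near: h; exact: cc.
  have : P h (Z h) by near: h.
  by case=> + _; apply.
have L' : (h^-1 *: (f (c (h *: 1 + t)) - f (c t)))
    @[h --> 0^'] --> \sum_i partial i f (c t) * dc i.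
  apply: cvg_trans L; apply: near_eq_cvg; near=> h.
  have : P h (Z h) by near: h.
  case=> _ E; rewrite [_%:A]mulr1 E [RHS]mulr_sumr.
  by apply: eq_bigr => i _; rewrite mulrCA.
by apply: DeriveDef; [apply/cvg_ex; eexists; exact: L'|exact/cvg_lim].
Unshelve. all: by end_near. Qed.

End Differential.

Lemma derive_lineE (R : realType) (V W : normedModType R) (f : V -> W) (x v : V) :
  'D_1 (fun h : R => f (h *: v + x)) 0 = 'D_v f x.
Proof.
rewrite /derive; set g1 := fun h => h^-1 *: _; set g2 := fun h => h^-1 *: _.
suff -> : g1 = g2 by [].
by apply/funext => h; rewrite /g1 /g2 /= addr0 scale0r add0r [_%:A]mulr1.
Qed.

(** * Lipschitz bounds, symmetry of second derivatives and the bootstrap *)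

Section DifferentialConsequences.
Context {R : realType} {n : nat}.
Implicit Types (U V : set 'rV[R]_n) (f : 'rV[R]_n -> R) (x y p : 'rV[R]_n).

Lemma is_derive_dir U f x (v : 'rV[R]_n) : open U -> smooth U f -> U x ->
  is_derive x v f (\sum_i partial i f x * v 0 i).
Proof.
move=> oU sf Ux.
have := @is_derive_curve R n U f (fun h => h *: v + x) 0 (fun i => v 0 i) oU sf.
rewrite scale0r add0r => /(_ Ux) [].
  move=> i; have -> : (fun s : R => (s *: v + x) 0 i) = (fun s => (x + s *: v) 0 i).
    by apply/funext => s; rewrite addrC.
  rewrite -(derive_coord v (x + 0 *: v) i).
  apply: (@is_derive_line R n (fun z => z 0 i)).
  exact/diff_derivable/differentiable_coord.
move=> dl vl; split; first exact: (derivable1P _ _ _).2.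
by rewrite -vl derive_lineE.
Qed.

Lemma derivative_bound (p : 'rV[R]_n) (r C : R) f x y :
  smooth (ball p r) f ->
  (forall i z, ball p r z -> `|partial i f z| <= C) ->
  ball p r x -> ball p r y -> `|f y - f x| <= n%:R * C * `|y - x|.
Proof.
move=> sf fC px py.
have [|z [zP ->]] := @mean_rV R n p r f x y _ px py.
  by move=> i z pz; exact: smooth_derivable sf pz.
apply: (le_trans (ler_norm_sum _ _ _)).
rewrite -mulrA mulr_natl -[X in _ *+ X]card_ord -sumr_const.
apply: ler_sum => i _; rewrite normrM; apply: ler_pM => //.
  exact: fC (zP i).1.
by have := rV_coord_le (y - x) i; rewrite !mxE.
Qed.

Lemma mean_coord f (a : 'rV[R]_n) k (d : R) :
  (forall t : R, 0 <= t <= 1 ->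
     derivable f (a + (t * d) *: delta_mx 0 k) (delta_mx 0 k)) ->
  exists2 t : R, 0 <= t <= 1 &
    f (a + d *: delta_mx 0 k) - f a =
    partial k f (a + (t * d) *: delta_mx 0 k) * d.
Proof.
move=> df.
have [|t t01 E] := @mean_value1 R (fun s => f (a + s *: delta_mx 0 k))
  (fun s => partial k f (a + s *: delta_mx 0 k)) d.
  by move=> t t01; apply: is_derive_line; exact: df.
by exists t => //; rewrite -E scale0r addr0.
Qed.

(** Two mean values are applied to the second difference of [f], in direction [i] to the increment
    [F] in direction [j], then in direction [j] to [partial i f]. The condition [h + h < r] keeps
    the whole parallelogram in the ball. *)
Let near_mixed U f x (i j : 'I_n) (r h : R) :
  ball x r `<=` U -> smooth U f -> 0 < h -> h + h < r ->
  exists2 z, ball x r z &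
    f (x + h *: delta_mx 0 i + h *: delta_mx 0 j) - f (x + h *: delta_mx 0 i)
    - f (x + h *: delta_mx 0 j) + f x = partial j (partial i f) z * h * h.
Proof.
move=> bU sf h0 hr.
have bz (s t : R) : 0 <= s <= 1 -> 0 <= t <= 1 ->
    ball x r (x + (s * h) *: delta_mx 0 i + (t * h) *: delta_mx 0 j).
  move=> /andP[s0 s1] /andP[t0 t1]; rewrite ball_rVE.
  rewrite addrAC [x + _]addrC addrK.
  apply: le_lt_trans (ler_normD _ _) _; apply: le_lt_trans hr.
  have B (u : R) (k : 'I_n) : 0 <= u -> u <= 1 -> `|(u * h) *: (delta_mx 0 k : 'rV[R]_n)| <= h.
    move=> u0 u1; rewrite normrZ ger0_norm ?mulr_ge0// ?(ltW h0)//.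
    apply: (@le_trans _ _ (u * h * 1)).
      by rewrite ler_wpM2l ?mulr_ge0 ?(ltW h0)//; exact: norm_delta_le.
    by rewrite mulr1 ler_piMl// ltW.
  by rewrite lerD// B.
have i01 : (0 : R) <= (0 : R) <= 1 by rewrite lexx ler01.
have i11 : (0 : R) <= (1 : R) <= 1 by rewrite ler01 lexx.
pose F z := f (z + h *: delta_mx 0 j) - f z.
have dF (s : R) : 0 <= s <= 1 -> is_derive (x + (s * h) *: delta_mx 0 i) (delta_mx 0 i) F
   (partial i f (x + (s * h) *: delta_mx 0 i + h *: delta_mx 0 j)
      - partial i f (x + (s * h) *: delta_mx 0 i)).
  move=> s01; apply: is_deriveB; last first.
    apply: derivableP; apply: smooth_derivable sf _; apply: bU.
    by have := bz s 0 s01 i01; rewrite mul0r scale0r addr0.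
  set y := x + _.
  have yU : U (y + h *: delta_mx 0 j).
    by apply: bU; have := bz s 1 s01 i11; rewrite mul1r.
  have dy := @smooth_derivable R n U f _ i sf yU.
  have E : (fun u : R => u^-1 *: (f (u *: delta_mx 0 i + y + h *: delta_mx 0 j) - f (y + h *: delta_mx 0 j)))
         = (fun u : R => u^-1 *: (f (u *: delta_mx 0 i + (y + h *: delta_mx 0 j)) - f (y + h *: delta_mx 0 j))).
    by apply/funext => u; rewrite (addrA (u *: delta_mx 0 i) y).
  by split; rewrite /partial /derivable /derive /= E.
have [|s s01 E] := @mean_coord F x i h.
  by move=> s s01; have [] := dF s s01.
have Ed : partial i F (x + (s * h) *: delta_mx 0 i) =
   partial i f (x + (s * h) *: delta_mx 0 i + h *: delta_mx 0 j)
      - partial i f (x + (s * h) *: delta_mx 0 i) by have [] := dF s s01.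
have [|t t01 E'] := @mean_coord (partial i f) (x + (s * h) *: delta_mx 0 i) j h.
  move=> t t01; apply: smooth_derivable (smooth_partial i sf) _.
  exact/bU/bz.
exists (x + (s * h) *: delta_mx 0 i + (t * h) *: delta_mx 0 j); first exact: bz.
by rewrite -E' -Ed -E /F; ring.
Qed.

Let half_close (a b c e : R) :
  `|a - c| < e / 2 -> `|b - c| < e / 2 -> `|a - b| <= e.
Proof. by rewrite !ltr_norml ler_norml; lra. Qed.

(** The second difference is symmetric in [i] and [j], so the two mixed derivatives agree at two
    points arbitrarily close to [x]; their continuity at [x] does the rest. *)
Lemma partialC U f x (i j : 'I_n) : open U -> smooth U f -> U x ->
  partial i (partial j f) x = partial j (partial i f) x.
Proof.
move=> oU sf Ux; apply/eqP; rewrite -subr_eq0 -normr_le0; apply/ler_addgt0Pl => e e0.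
rewrite addr0.
have H (k l : 'I_n) : \forall z \near x, `|partial k (partial l f) x - partial k (partial l f) z| < e / 2.
  have := smooth_continuous (smooth_partial k (smooth_partial l sf)) Ux.
  by move/cvgrPdist_lt; apply; rewrite divr_gt0.
have : nbhs x [set z | [/\ U z, `|partial i (partial j f) x - partial i (partial j f) z| < e / 2
    & `|partial j (partial i f) x - partial j (partial i f) z| < e / 2]].
  have nU : nbhs x U by exact: open_nbhs_nbhs.
  apply: filterS (filterI nU (filterI (H i j) (H j i))) => z /= [? [? ?]].
  by split.
move=> /nbhs_ballP[r /= r0 rP].
have bU : ball x r `<=` U by move=> z /rP[].
have [d d0 dr] : exists2 d : R, 0 < d & d + d < r.
  by exists (r / 3); lra.
have [z bz E] := @near_mixed U f x i j r d bU sf d0 dr.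
have [w bw E'] := @near_mixed U f x j i r d bU sf d0 dr.
have {E E'} E : partial j (partial i f) z = partial i (partial j f) w.
  have EA : f (x + d *: delta_mx 0 j + d *: delta_mx 0 i) =
            f (x + d *: delta_mx 0 i + d *: delta_mx 0 j) by congr f; exact: addrAC.
  move: E'; rewrite EA => E'; clear EA.
  move: E E'; move: (f _) (f _) (f _) (f _) (partial _ _ _) (partial _ _ _).
  move=> a1 a2 a3 a4 u v E E'; have dn : d != 0 by rewrite gt_eqF.
  apply: (mulIf dn); apply: (mulIf dn); rewrite -E -E'.
  by congr (_ + _); exact: addrAC.
have [_ _ A] := rP _ bz; have [_ B _] := rP _ bw.
by rewrite -E in B; exact: (half_close B A).
Qed.

(** The bootstrap for families whose partial derivatives are expressed through the family itself,
    such as solutions of linear systems and inverse maps. *)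
Lemma smooth_system U (I : Type) (u : I -> 'rV[R]_n -> R) :
  (forall a x, U x -> {for x, continuous (u a)}) ->
  (forall a k x, U x -> derivable (u a) x (delta_mx 0 k)) ->
  (forall m, (forall a, Ck U m (u a)) -> forall a k, Ck U m (partial k (u a))) ->
  forall a, smooth U (u a).
Proof.
move=> cu du pu a; apply/smoothP => m; elim: m a => [|m IH] a.
  by split => // x; exact: cu.
split; first by move=> x; exact: cu.
by move=> i; split; [move=> x; exact: du|exact: pu].
Qed.

End DifferentialConsequences.

(** * Chain rule and regularity of composites *)

Section Composition.
Context {R : realType} {m n : nat}.
Implicit Types (W : set 'rV[R]_m) (U : set 'rV[R]_n) (x : 'rV[R]_m -> 'rV[R]_n).

Lemma continuous_rV x (q : 'rV[R]_m) :
  (forall i, {for q, continuous (fun z => x z 0 i)}) -> {for q, continuous x}.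
Proof.
move=> cx.
suff : x z @[z --> q] --> x q by [].
apply/(@cvgrPdist_le _ _ _ (nbhs q) (nbhs_filter q)) => e e0.
have H i : \forall z \near q, `|x q 0 i - x z 0 i| <= e.
  by move: (cx i) => /cvgrPdist_le; apply.
near=> z; apply: rV_norm_le; first exact: ltW.
by move=> i; rewrite !mxE; move: i; near: z; exact: filter_forall.
Unshelve. all: by end_near. Qed.

Lemma is_derive_comp_rV U (F : 'rV[R]_n -> R) x (q v : 'rV[R]_m) :
  open U -> smooth U F -> U (x q) ->
  (forall i, derivable (fun z => x z 0 i) q v) ->
  is_derive q v (fun z => F (x z))
    (\sum_i partial i F (x q) * 'D_v (fun z => x z 0 i) q).
Proof.
move=> oU sF Uq dx.
have := @is_derive_curve R n U F (fun h => x (h *: v + q)) 0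
  (fun i => 'D_v (fun z => x z 0 i) q) oU sF.
rewrite scale0r add0r => /(_ Uq) [].
  move=> i; split; first exact: (derivable1P (fun z => x z 0 i) _ _).1 (dx i).
  exact: (derive_lineE (fun z => x z 0 i)).
move=> dl vl; split; first exact: (derivable1P (fun z => F (x z)) _ _).2.
by rewrite -vl (derive_lineE (fun z => F (x z))).
Qed.

Lemma partial_comp U (F : 'rV[R]_n -> R) x (q : 'rV[R]_m) k :
  open U -> smooth U F -> U (x q) ->
  (forall i, derivable (fun z => x z 0 i) q (delta_mx 0 k)) ->
  partial k (fun z => F (x z)) q =
  \sum_i partial i F (x q) * partial k (fun z => x z 0 i) q.
Proof. by move=> oU sF Uq dx; have [] := is_derive_comp_rV oU sF Uq dx. Qed.

(** The induction on [k] varies [F], since the chain rule replaces it by its partial derivatives.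
    The inner map only needs order [k], which is what the bootstrap for an inverse map can offer. *)
Lemma Ck_comp W U k (F : 'rV[R]_n -> R) x :
  open W -> open U -> smooth U F -> (forall q, W q -> U (x q)) ->
  (forall i, Ck W k (fun z => x z 0 i)) -> Ck W k (fun z => F (x z)).
Proof.
move=> oW oU + WU; elim: k F => [|k IH] F sF cx.
  split=> // q Wq; have xq : {for q, continuous x}.
    by apply: continuous_rV => i; exact: (cx i).1.
  exact: (continuous_comp xq (smooth_continuous sF (WU q Wq))).
split.
  move=> q Wq; have xq : {for q, continuous x}.
    by apply: continuous_rV => i; exact: (cx i).1.
  exact: (continuous_comp xq (smooth_continuous sF (WU q Wq))).
move=> l; split.
  move=> q Wq; have [|//] := @is_derive_comp_rV U F x q (delta_mx 0 l) oU sF (WU q Wq).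
  by move=> i; exact: ((cx i).2 l).1.
refine (@eq_Ck R m W k (fun z => \sum_i partial i F (x z) * partial l (fun y => x y 0 i) z) _ oW _ _).
  move=> q /set_mem Wq; rewrite (partial_comp oU sF (WU q Wq))// => i.
  exact: ((cx i).2 l).1.
apply: Ck_sum => // i _; apply: CkM => //; last exact: ((cx i).2 l).2.
by apply: IH => [|j]; [exact: smooth_partial|exact: CkW].
Qed.

End Composition.

(** * Averages along rays *)

Section UnitInterval.
Context {R : realType}.
Let mu : {measure set _ -> \bar R} := @lebesgue_measure R.

Definition int01 (f : R -> R) : R := \int[mu]_(t in `[0, 1]) f t.

(** Two-sided continuity also at the endpoints: the integrands come from rays inside an open ball,
    hence make sense slightly beyond the interval. *)
Definition continuous01 (f : R -> R) :=
  forall t : R, 0 <= t <= 1 -> {for t, continuous f}.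

Lemma continuous01_within f : continuous01 f -> {within `[0, 1], continuous f}.
Proof.
move=> cf; apply: continuous_in_subspaceT => t.
by rewrite inE /= in_itv /=; exact: cf.
Qed.

Lemma continuous01_integrable f : continuous01 f ->
  mu.-integrable `[0, 1] (EFin \o f).
Proof.
move=> cf; apply: continuous_compact_integrable; first exact: segment_compact.
exact: continuous01_within.
Qed.

Lemma eq_int01 f g : (forall t : R, 0 <= t <= 1 -> f t = g t) -> int01 f = int01 g.
Proof.
by move=> fg; apply: eq_Rintegral => t; rewrite inE /= in_itv /=; exact: fg.
Qed.

Lemma int01_cst (c : R) : int01 (fun=> c) = c.
Proof.
rewrite /int01 Rintegral_cst//= lebesgue_measure_itv/= lte_fin ltr01.
by rewrite oppr0 adde0 /= mulr1.
Qed.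

Lemma int01D f g : continuous01 f -> continuous01 g ->
  int01 (fun t => f t + g t) = int01 f + int01 g.
Proof. by move=> cf cg; apply: RintegralD => //; exact: continuous01_integrable. Qed.

Lemma int01B f g : continuous01 f -> continuous01 g ->
  int01 (fun t => f t - g t) = int01 f - int01 g.
Proof. by move=> cf cg; apply: RintegralB => //; exact: continuous01_integrable. Qed.

Lemma int01Z (c : R) f : continuous01 f ->
  int01 (fun t => c * f t) = c * int01 f.
Proof. by move=> cf; apply: RintegralZl => //; exact: continuous01_integrable. Qed.

Lemma continuous01_cst (c : R) : continuous01 (fun=> c).
Proof. by move=> t _; exact: cst_continuous. Qed.

Lemma continuous01_sum (I : Type) (s : seq I) (F : I -> R -> R) :
  (forall i, continuous01 (F i)) -> continuous01 (fun t => \sum_(i <- s) F i t).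
Proof.
move=> cF t t01; apply: cvg_big; first exact: add_continuous.
by move=> i _; exact: cF.
Qed.

Lemma int01_sum (I : Type) (s : seq I) (F : I -> R -> R) :
  (forall i, continuous01 (F i)) ->
  int01 (fun t => \sum_(i <- s) F i t) = \sum_(i <- s) int01 (F i).
Proof.
move=> cF; elim: s => [|i s IH].
  by rewrite big_nil -[RHS]int01_cst; apply: eq_int01 => t _; rewrite big_nil.
rewrite big_cons -IH -int01D//; last exact: continuous01_sum.
by apply: eq_int01 => t _; rewrite big_cons.
Qed.

Lemma int01_bound f (C : R) : continuous01 f ->
  (forall t : R, 0 <= t <= 1 -> `|f t| <= C) -> `|int01 f| <= C.
Proof.
move=> cf fC.
have cnf : continuous01 (fun t => `|f t|).
  by move=> t t01; apply: (continuous_comp (cf t t01)); exact: norm_continuous.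
apply: (le_trans (le_normr_Rintegral _ (continuous01_integrable cf))) => //.
rewrite -[leRHS]int01_cst.
apply: (le_Rintegral _ (continuous01_integrable cnf)
  (continuous01_integrable (@continuous01_cst C))) => //.
Qed.

Lemma int01_FTC (F f : R -> R) : continuous01 f ->
  (forall t : R, 0 <= t <= 1 -> is_derive t 1 F (f t)) -> int01 f = F 1 - F 0.
Proof.
move=> cf dF.
have cF t : 0 <= t <= 1 -> {for t, continuous F}.
  move=> t01; apply/differentiable_continuous; rewrite -derivable1_diffP.
  by have [] := dF t t01.
rewrite /int01 /Rintegral (@continuous_FTC2 R f F 0 1)//.
- exact: continuous01_within.
- split.
  + by move=> t; rewrite in_itv /= => /andP[t0 t1]; have [|//] := dF t; rewrite !ltW.
  + by apply: cvg_at_right_filter; apply: cF; rewrite lexx ler01.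
  + by apply: cvg_at_left_filter; apply: cF; rewrite ler01 lexx.
- move=> t; rewrite in_itv /= => /andP[t0 t1]; rewrite derive1E.
  by have [|//] := dF t; rewrite !ltW.
Qed.

End UnitInterval.

Section RayMean.
Context {R : realType} {n : nat}.
Variables (p : 'rV[R]_n) (r : R).
Implicit Types (h : 'rV[R]_n -> R) (x : 'rV[R]_n).

Let B := ball p r.
Let oB : open B. Proof. exact: ball_open. Qed.

(** The weight [t ^+ a] makes the family closed under differentiation: each partial derivative in
    [x] brings out one more factor [t]. *)
Definition ray_mean (a : nat) h x : R :=
  int01 (fun t => t ^+ a * h (p + t *: (x - p))).

Lemma is_derive_ray h x (t : R) : smooth B h -> B x -> 0 <= t <= 1 ->
  is_derive t 1 (fun s => h (p + s *: (x - p)))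
    (\sum_j (x 0 j - p 0 j) * partial j h (p + t *: (x - p))).
Proof.
move=> sh Bx t01.
have [dl dv] := is_derive_dir (x - p) oB sh (ball_segment Bx t01).
have := is_derive_line dl; rewrite dv.
by congr is_derive; apply: eq_bigr => j _; rewrite !mxE mulrC.
Qed.

Lemma continuous01_ray a h x : smooth B h -> B x ->
  continuous01 (fun t => t ^+ a * h (p + t *: (x - p))).
Proof.
move=> sh Bx t t01; apply: cvgM; first exact: exprn_continuous.
apply/differentiable_continuous; rewrite -derivable1_diffP.
by have [] := is_derive_ray sh Bx t01.
Qed.

Lemma ray_mean_bound a h x (C : R) : smooth B h -> B x ->
  (forall y, B y -> `|h y| <= C) -> `|ray_mean a h x| <= C.
Proof.
move=> sh Bx hC; apply: int01_bound; first exact: continuous01_ray.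
move=> t t01; have := hC _ (ball_segment Bx t01); move/andP: t01 => [t0 t1].
move=> H; rewrite normrM normrX (ger0_norm t0); apply: le_trans H.
by rewrite ler_piMl// exprn_ile1.
Qed.

(** Integrate the derivative of [t * h (p + t *: (x - p))] over the unit interval. *)
Lemma ray_mean_id h x : smooth B h -> B x ->
  ray_mean 0 h x + \sum_j (x 0 j - p 0 j) * ray_mean 1 (partial j h) x = h x.
Proof.
move=> sh Bx.
have cp j : continuous01 (fun t => t ^+ 1 * partial j h (p + t *: (x - p))).
  exact: (@continuous01_ray 1%N _ x (smooth_partial j sh) Bx).
have cp' j : continuous01 (fun t => (x 0 j - p 0 j) * (t ^+ 1 * partial j h (p + t *: (x - p)))).
  by move=> t t01; apply: cvgM; [exact: cst_continuous|exact: cp].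
have c0 := @continuous01_ray 0 h x sh Bx.
transitivity (int01 (fun t => t ^+ 0 * h (p + t *: (x - p)) +
   \sum_j (x 0 j - p 0 j) * (t ^+ 1 * partial j h (p + t *: (x - p))))).
  rewrite int01D//; last exact: continuous01_sum.
  by congr (_ + _); rewrite int01_sum//; apply: eq_bigr => j _; rewrite int01Z.
pose F t := t * h (p + t *: (x - p)).
have -> : h x = F 1 - F 0.
  by rewrite /F mul1r mul0r subr0 scale1r addrC subrK.
apply: int01_FTC.
  by move=> t t01; apply: cvgD; [exact: c0|exact: continuous01_sum].
move=> t t01; have D := is_derive_ray sh Bx t01.
have := is_deriveM (is_derive_id t 1) D; congr is_derive.
rewrite expr0 mul1r [_%:A]mulr1 addrC; congr (_ + _).
by rewrite [LHS]mulr_sumr; apply: eq_bigr => j _; rewrite expr1 mulrCA.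
Qed.

Lemma smooth_bounded_subball h (s : R) : smooth B h -> 0 < s -> s < r ->
  exists C, 0 <= C /\ forall y, `|y - p| <= s -> `|h y| <= C.
Proof.
move=> sh s0 sr.
pose A := [set y : 'rV[R]_n | `|y - p| <= s].
have AE : closed_ball p s = A.
  by rewrite closed_ballE//; apply/seteqP; split=> y; rewrite /closed_ball_ /A /= distrC.
have cA : compact A.
  apply: bounded_closed_compact; last by rewrite -AE; exact: closed_ball_closed.
  exists (`|p| + s); split; first exact: num_real.
  move=> M ltM y /= yA; apply: le_trans (ltW ltM).
  rewrite -[y](subrK p) addrC; apply: (le_trans (ler_normD _ _)).
  by rewrite lerD2l.
have cf : {within A, continuous h}.
  apply: continuous_in_subspaceT => y; rewrite inE => yA.
  apply: (smooth_continuous sh); rewrite /B ball_rVE; exact: le_lt_trans sr.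
have [M [_ MP]] := compact_bounded (continuous_compact cf cA).
exists (Num.max 0 (M + 1)); split; first by rewrite le_max lexx.
move=> y yA; rewrite le_max; apply/orP; right; apply: MP.
  by rewrite ltrDl.
by exists y.
Qed.

(** Differentiation under the integral sign. The dominating function is a constant, a bound for
    [partial k h] on a closed ball of radius less than [r], because [partial k h] may be unbounded
    on the whole ball. *)
Lemma is_derive_ray_mean a h x k : smooth B h -> B x ->
  is_derive x (delta_mx 0 k) (ray_mean a h) (ray_mean a.+1 (partial k h) x).
Proof.
move=> sh Bx.
have xr : `|x - p| < r by rewrite -ball_rVE.
(* Half the distance left to the boundary: moving [x] by less than [d] keeps all rays within
   distance [s < r] of [p]. *)
pose d := (r - `|x - p|) / 2.
have d0 : 0 < d by rewrite divr_gt0// subr_gt0.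
pose s := `|x - p| + d.
have sr : s < r by rewrite /s /d; lra.
have s0 : 0 < s by rewrite ltr_wpDl.
have [C [C0 CP]] := smooth_bounded_subball (smooth_partial k sh) s0 sr.
have near_s (u : R) : - d < u -> u < d -> `|(x + u *: delta_mx 0 k) - p| <= s.
  move=> du ud; rewrite addrAC; apply: (le_trans (ler_normD _ _)).
  rewrite lerD2l normrZ; apply: (@le_trans _ _ (`|u| * 1)).
    by rewrite ler_wpM2l//; exact: norm_delta_le.
  by rewrite mulr1 ltW// ltr_norml du ud.
have near_B (u : R) : - d < u -> u < d -> B (x + u *: delta_mx 0 k).
  by move=> du ud; rewrite /B ball_rVE; apply: le_lt_trans sr; exact: near_s.
pose f (u t : R) := t ^+ a * h (p + t *: (x + u *: delta_mx 0 k - p)).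
have df (u t : R) : - d < u -> u < d -> 0 <= t <= 1 ->
    is_derive u 1 (f ^~ t)
      (t ^+ a.+1 * partial k h (p + t *: (x + u *: delta_mx 0 k - p))).
  move=> du ud t01.
  have Bz := ball_segment (near_B u du ud) t01.
  have E (w : R) : p + t *: (x + w *: delta_mx 0 k - p) =
     (p + t *: (x - p)) + w *: (t *: delta_mx 0 k).
    by apply/rowP => j; rewrite !mxE; ring.
  rewrite E in Bz.
  have [dl dv] := is_derive_dir (t *: delta_mx 0 k) oB sh Bz.
  have D := is_derive_line dl; rewrite dv in D.
  have := is_deriveM (is_derive_cst (t ^+ a) u 1) D.
  have -> : (fun v : R => f v t) =
     (fun w => t ^+ a * h (p + t *: (x - p) + w *: (t *: delta_mx 0 k))).
    by apply/funext => w; rewrite /f E.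
  congr is_derive.
  rewrite scaler0 addr0 E (bigD1 k)//= big1 ?addr0.
    by rewrite !mxE !eqxx mulr1 exprSr -mulrA [_ * t]mulrC.
  by move=> j jk; rewrite !mxE (negbTE jk) andbF !mulr0.
have /= := @cvg_differentiation_under_integral R _ _ (@lebesgue_measure R) f `[0, 1]
  _ 0 (- d) d _ _ _ (fun=> C).
have -> // : \int[lebesgue_measure]_(y in `[0, 1]) partial1of2 f 0 y =
   ray_mean a.+1 (partial k h) x.
  apply: eq_Rintegral => t; rewrite inE /= in_itv /= => t01.
  rewrite partial1of2E; have [||//|_ ->] := df 0 t; rewrite ?oppr_lt0//.
  by rewrite scale0r addr0.
have I0 (u : R) : u \in `]- d, d[ -> - d < u /\ u < d by rewrite in_itv => /andP[].
have I1 (t : R) : t \in `[0, 1] -> 0 <= t <= 1 by rewrite in_itv.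
move=> H; have L : h0^-1 *: (int01 (f (h0 + 0)) - int01 (f 0)) @[h0 --> 0^'] -->
    ray_mean a.+1 (partial k h) x.
  apply: H => //.
  - by rewrite in_itv /= oppr_lt0 d0.
  - by move=> u /I0[du ud]; apply: continuous01_integrable; exact: continuous01_ray sh (near_B u du ud).
  - by move=> u t /I0[du ud] /I1 t01; have [] := df u t du ud t01.
  - exact: continuous01_integrable (@continuous01_cst _ C).
  - move=> u t /I0[du ud] /I1 t01; rewrite partial1of2E; have [_ ->] := df u t du ud t01.
    have /andP[t0 t1] := t01; rewrite normrM normrX (ger0_norm t0).
    have yC : `|partial k h (p + t *: (x + u *: delta_mx 0 k - p))| <= C.
      apply: CP; rewrite addrAC subrr add0r normrZ (ger0_norm t0).
      by apply: le_trans (near_s u du ud); rewrite ler_piMl.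
    by apply: le_trans yC; rewrite ler_piMl// exprn_ile1.
have E : (fun h0 : R => h0^-1 *: (int01 (f (h0 + 0)) - int01 (f 0))) =
   (fun h0 : R => h0^-1 *: (ray_mean a h (h0 *: delta_mx 0 k + x) - ray_mean a h x)).
  apply/funext => u; rewrite /ray_mean /f addr0 scale0r addr0.
  by rewrite (addrC (u *: delta_mx 0 k) x).
rewrite E in L.
by split; [apply/cvg_ex; eexists; exact: L|apply/cvg_lim => //; exact: L].
Qed.

(** The points at parameter [t] of the rays to [x] and [y] differ by [t *: (x - y)], so bounds for
    the partial derivatives of [h] on a slightly smaller ball make the mean Lipschitz near [x]. *)
Lemma ray_mean_continuous a h x : smooth B h -> B x ->
  {for x, continuous (ray_mean a h)}.
Proof.
move=> sh Bx.
have xr : `|x - p| < r by rewrite -ball_rVE.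
have [s xs sr] : exists2 s : R, `|x - p| < s & s < r.
  by exists ((`|x - p| + r) / 2); [rewrite ltr_pdivlMr|rewrite ltr_pdivrMr]; lra.
have s0 : 0 < s by exact: le_lt_trans xs.
have sB : ball p s `<=` B by move=> y; rewrite /B !ball_rVE => /lt_trans; apply.
have [C CP] := choice (fun i => smooth_bounded_subball (smooth_partial i sh) s0 sr).
pose M := \sum_i C i.
have CM i : C i <= M.
  by rewrite /M (bigD1 i)//= lerDl sumr_ge0// => j _; exact: (CP j).1.
have M0 : 0 <= M by rewrite sumr_ge0// => j _; exact: (CP j).1.
have lip y : ball p s y -> `|ray_mean a h x - ray_mean a h y| <= n%:R * M * `|x - y|.
  move=> sy; have By := sB _ sy.
  have cx := @continuous01_ray a h x sh Bx; have cy := @continuous01_ray a h y sh By.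
  rewrite /ray_mean -int01B//; apply: int01_bound.
    by move=> t t01; apply: cvgB; [exact: cx|exact: cy].
  move=> t t01; have /andP[t0 t1] := t01.
  rewrite -mulrBr normrM normrX (ger0_norm t0).
  have sx : ball p s x by rewrite ball_rVE.
  have H := @derivative_bound R n p s M h _ _ (smooth_sub sB sh) _
    (ball_segment sy t01) (ball_segment sx t01).
  apply: (@le_trans _ _ (n%:R * M * `|p + t *: (x - p) - (p + t *: (y - p))|)).
    apply: (le_trans _ (H _)).
      by rewrite ler_piMl// exprn_ile1.
    move=> i z; rewrite ball_rVE => /ltW zs.
    exact: le_trans ((CP i).2 z zs) (CM i).
  apply: ler_wpM2l; first by rewrite mulr_ge0.
  have -> : p + t *: (x - p) - (p + t *: (y - p)) = t *: (x - y).
    by apply/rowP => j; rewrite !mxE; ring.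
  by rewrite normrZ (ger0_norm t0) ler_piMl.
suff : ray_mean a h z @[z --> x] --> ray_mean a h x by [].
apply/(@cvgrPdist_lt _ _ _ (nbhs x) (nbhs_filter x)) => e e0.
pose K := n%:R * M + 1.
have K0 : 0 < K by rewrite ltr_pwDr// mulr_ge0.
have eK : 0 < e / K by rewrite divr_gt0.
have nb : nbhs x (ball p s `&` ball x (e / K)).
  apply: filterI; last exact: nbhsx_ballx.
  by apply: open_nbhs_nbhs; split; [exact: ball_open|rewrite ball_rVE].
apply: filterS nb => y [sy]; rewrite ball_rVE => xy.
apply: (le_lt_trans (lip y sy)); rewrite distrC.
apply: (@le_lt_trans _ _ (K * `|y - x|)); first by rewrite ler_wpM2r// lerDl.
by rewrite mulrC -ltr_pdivlMr.
Qed.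

Lemma smooth_ray_mean a h : smooth B h -> smooth B (ray_mean a h).
Proof.
move=> sh; apply/smoothP => m; elim: m a h sh => [|m IH] a h sh.
  by split=> // x Bx; exact: ray_mean_continuous.
split; first by move=> x Bx; exact: ray_mean_continuous.
move=> i; split; first by move=> x Bx; have [] := is_derive_ray_mean a i sh Bx.
refine (eq_Ck oB _ (IH a.+1 (partial i h) (smooth_partial i sh))) => x /set_mem Bx.
by rewrite /partial; have [_ ->] := is_derive_ray_mean a i sh Bx.
Qed.

End RayMean.

(** * Uniform limits *)

Section PartialRules.
Context {R : realType} {n : nat}.
Implicit Types (U : set 'rV[R]_n) (f : 'rV[R]_n -> R) (x : 'rV[R]_n) (k : 'I_n).

Lemma partial_cst k (c : R) x : partial k (fun=> c) x = 0.
Proof. exact: derive_cst. Qed.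

Lemma partialD U k f1 f2 x : smooth U f1 -> smooth U f2 -> U x ->
  partial k (fun z => f1 z + f2 z) x = partial k f1 x + partial k f2 x.
Proof.
by move=> s1 s2 Ux; exact: (deriveD (smooth_derivable (i:=k) s1 Ux) (smooth_derivable (i:=k) s2 Ux)).
Qed.

Lemma partialB U k f1 f2 x : smooth U f1 -> smooth U f2 -> U x ->
  partial k (fun z => f1 z - f2 z) x = partial k f1 x - partial k f2 x.
Proof.
by move=> s1 s2 Ux; exact: (deriveB (smooth_derivable (i:=k) s1 Ux) (smooth_derivable (i:=k) s2 Ux)).
Qed.

Lemma partialM U k f1 f2 x : smooth U f1 -> smooth U f2 -> U x ->
  partial k (fun z => f1 z * f2 z) x = partial k f1 x * f2 x + f1 x * partial k f2 x.
Proof.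
move=> s1 s2 Ux.
rewrite /partial (deriveM (smooth_derivable (i:=k) s1 Ux) (smooth_derivable (i:=k) s2 Ux)).
by rewrite addrC [_ *: _]mulrC.
Qed.

Lemma partial_sum U k (I : Type) (s : seq I) (F : I -> 'rV[R]_n -> R) x :
  open U -> (forall i, smooth U (F i)) -> U x ->
  partial k (fun z => \sum_(i <- s) F i z) x = \sum_(i <- s) partial k (F i) x.
Proof.
move=> oU sF Ux; elim: s => [|i s IH].
  rewrite big_nil -[RHS](partial_cst k 0 x).
  by congr (partial k _ x); apply/funext => z; rewrite big_nil.
rewrite big_cons -IH -(partialD k (sF i) _ Ux); last exact: smooth_sum.
by congr (partial k _ x); apply/funext => z; rewrite big_cons.
Qed.

Lemma partialMcst U k (c : R) f x : smooth U f -> U x ->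
  partial k (fun z => c * f z) x = c * partial k f x.
Proof.
by move=> sf Ux; rewrite (partialM k (smooth_cst U c) sf Ux) partial_cst mul0r add0r.
Qed.

End PartialRules.

Section LocalBound.
Context {R : realType} {n : nat}.
Implicit Types (U : set 'rV[R]_n) (p : 'rV[R]_n).

Lemma open_ball_sub U p : open U -> U p ->
  exists2 r : R, 0 < r & ball p r `<=` U.
Proof.
move=> oU Up; have /nbhs_ballP[r r0 rU] : nbhs p U by exact: open_nbhs_nbhs.
by exists r.
Qed.

Lemma sub_ball p (r s : R) : s <= r -> ball p s `<=` ball p r.
Proof. by move=> sr x; rewrite !ball_rVE => /lt_le_trans; apply. Qed.

Lemma locally_bounded U p (I : finType) (f : I -> 'rV[R]_n -> R) :
  open U -> U p -> (forall i, {for p, continuous (f i)}) ->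
  exists r C : R, [/\ 0 < r, 0 <= C, ball p r `<=` U &
    forall i x, ball p r x -> `|f i x| <= C].
Proof.
move=> oU Up cf; pose C := \sum_i `|f i p| + 1.
have H i : \forall x \near p, `|f i p - f i x| < 1.
  by move: (cf i) => /cvgrPdist_lt; apply.
have H' := filter_forall (nbhs_filter p) H.
have nU : nbhs p U by exact: open_nbhs_nbhs.
have : nbhs p (U `&` [set x | forall i, `|f i p - f i x| < 1]).
  exact: filterI nU H'.
move=> /nbhs_ballP[r /= r0 rP]; exists r, C; split=> //.
- by rewrite addr_ge0// sumr_ge0.
- by move=> x /rP[].
move=> i x /rP[_ /(_ i)] fx.
have : `|f i p| <= \sum_i `|f i p| by rewrite (bigD1 i)//= lerDl sumr_ge0.
have := ler_normB (f i p) (f i p - f i x).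
by rewrite opprB addrC subrK /C; move: fx; clear; lra.
Qed.

End LocalBound.

Section UniformLimit.
Context {R : realType} {n : nat}.
Implicit Types (p x : 'rV[R]_n).

(** The passage to the limit in all later estimates: a quantity bounded by [c / 2 ^+ m] for every
    [m] is at most zero. *)
Lemma le_half_pow (a b c : R) : (forall m, a <= b + c / 2 ^+ m) -> a <= b.
Proof.
move=> H.
have cv : (b + c / 2 ^+ m) @[m --> \oo] --> b.
  rewrite -[X in _ --> X]addr0; apply: cvgD; first exact: cvg_cst.
  rewrite -[X in _ --> X](mulr0 c); apply: cvgM; first exact: cvg_cst.
  have -> : (fun m : nat => (2 ^+ m)^-1) = (fun m => (2^-1 : R) ^+ m).
    by apply/funext => m; rewrite exprVn.
  by apply: cvg_expr; rewrite ger0_norm ?invr_ge0// invf_lt1 ?ltr1n.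
have <- := cvg_lim _ cv => //.
apply: limr_ge; first by apply/cvg_ex; exists b.
exact: nearW.
Qed.

Lemma halving_limit (u : nat -> R) (A : R) :
  (forall m, `|u m.+1 - u m| <= A / 2 ^+ m) ->
  exists l, forall m, `|l - u m| <= 2 * A / 2 ^+ m.
Proof.
move=> H.
(* Keeping the subtracted term of the geometric sum is what lets the induction on [k] close. *)
have tail m k : `|u (m + k)%N - u m| <= 2 * A / 2 ^+ m - 2 * A / 2 ^+ (m + k).
  elim: k => [|k IH]; first by rewrite addn0 !subrr normr0.
  have := ler_distD (u (m + k)%N) (u (m + k.+1)%N) (u m).
  move/le_trans; apply; rewrite addnS.
  have := lerD (H (m + k)%N) IH; move/le_trans; apply.
  rewrite exprS invfM [X in _ <= _ - X]mulrA.
  have -> : 2 * A / 2 = A by rewrite mulrAC divff// mul1r.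
  set c := A / 2 ^+ (m + k); have -> : 2 * A / 2 ^+ (m + k) = 2 * c by rewrite mulrA.
  lra.
have A0 : 0 <= A by have := le_trans (normr_ge0 _) (H 0%N); rewrite expr0 divr1.
have tail' m k : `|u (m + k)%N - u m| <= 2 * A / 2 ^+ m.
  by apply: (le_trans (tail m k)); rewrite gerBl divr_ge0 ?mulr_ge0 ?exprn_ge0.
have cu : cvgn u.
  apply/cauchy_cvgP; apply/cauchy_exP => e e0.
  have [m mP] : exists m, 2 * A / 2 ^+ m < e.
    apply: contrapT => /forallNP N.
    have : e <= 0.
      apply: (@le_half_pow _ _ (2 * A)) => m; rewrite add0r leNgt.
      by apply/negP; exact: N.
    by rewrite leNgt e0.
  exists (u m); exists m => // k /= mk.
  rewrite -ball_normE /= distrC; apply: le_lt_trans mP.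
  by rewrite -(subnKC mk).
exists (lim (u @ \oo)) => m; apply/ler_addgt0Pr => e e0.
have : \forall k \near \oo, `|lim (u @ \oo) - u k| < e.
  by move/cvgrPdist_lt : cu; apply.
move=> [K _ KP]; have := KP (m + K)%N (leq_addl _ _) => /= hK.
have := ler_distD (u (m + K)%N) (lim (u @ \oo)) (u m).
move/le_trans; apply; rewrite addrC.
by apply: lerD; [exact: tail'|exact: ltW].
Qed.

Variables (p : 'rV[R]_n) (r A : R) (f : nat -> 'rV[R]_n -> R).
Variables (F G : 'rV[R]_n -> R).
Let B := ball p r.
Hypothesis fF : forall m x, B x -> `|F x - f m x| <= A / 2 ^+ m.

Lemma uniform_limit_continuous x : B x ->
  (forall m, {for x, continuous (f m)}) -> {for x, continuous F}.
Proof.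
move=> Bx cf; suff : F z @[z --> x] --> F x by [].
apply/(@cvgrPdist_lt _ _ _ (nbhs x) (nbhs_filter x)) => e e0.
have [m mP] : exists m, A / 2 ^+ m < e / 3.
  apply: contrapT => /forallNP N.
  have : e / 3 <= 0.
    apply: (@le_half_pow _ _ A) => m; rewrite add0r leNgt.
    by apply/negP; exact: N.
  by rewrite leNgt divr_gt0.
have H : \forall z \near x, `|f m x - f m z| < e / 3.
  by move: (cf m) => /cvgrPdist_lt; apply; rewrite divr_gt0.
have nB : nbhs x B by apply: open_nbhs_nbhs; split => //; exact: ball_open.
apply: filterS (filterI nB H) => z /= [Bz Hz].
have h1 := le_lt_trans (fF m Bx) mP; have h2 := le_lt_trans (fF m Bz) mP.
move: h1 h2 Hz; move: (F x) (F z) (f m x) (f m z) => a b c d {mP H nB}.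
rewrite !ltr_norml; lra.
Qed.

(** The mean value theorem is applied to [f m], not to [F]. With the increment [h] fixed, the
    comparison errors disappear as [m] grows, and only the oscillation of [G] near [x] remains. *)
Lemma uniform_limit_derive x k : B x ->
  (forall m z, B z -> derivable (f m) z (delta_mx 0 k)) ->
  (forall m z, B z -> `|G z - partial k (f m) z| <= A / 2 ^+ m) ->
  {for x, continuous G} ->
  is_derive x (delta_mx 0 k) F (G x).
Proof.
move=> Bx df fG cG.
have L : h^-1 *: (F (h *: delta_mx 0 k + x) - F x) @[h --> 0^'] --> G x.
  apply/cvgrPdist_le => e e0.
  have H : \forall z \near x, `|G x - G z| < e.
    by move: cG => /cvgrPdist_lt; apply.
  have nB : nbhs x B by apply: open_nbhs_nbhs; split => //; exact: ball_open.
  have : nbhs x (B `&` [set z | `|G x - G z| < e]) by exact: filterI nB H.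
  move=> /nbhs_ballP[d /= d0 dP].
  near=> h.
  have hn0 : h != 0 by near: h; exact: nbhs_dnbhs_neq.
  have hd : `|h| < d by near: h; exact: dnbhs0_lt.
  have zd (t : R) : 0 <= t <= 1 -> ball x d (x + (t * h) *: delta_mx 0 k).
    move=> /andP[t0 t1]; rewrite ball_rVE [x + _]addrC addrK normrZ.
    apply: le_lt_trans hd; apply: (@le_trans _ _ (`|t * h| * 1)).
      by rewrite ler_wpM2l//; exact: norm_delta_le.
    by rewrite mulr1 normrM (ger0_norm t0) ler_piMl.
  have i11 : 0 <= (1 : R) <= 1 by rewrite ler01 lexx.
  have BhU : B (x + h *: delta_mx 0 k).
    by have := zd 1 i11; rewrite mul1r => /dP[].
  have key m : `|F (x + h *: delta_mx 0 k) - F x - h * G x| <=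
      `|h| * e + (2 + `|h|) * A / 2 ^+ m.
    have [|t t01 E] := @mean_coord R n (f m) x k h.
      by move=> t t01; apply: df; have [] := dP _ (zd t t01).
    have [Bz Gz] := dP _ (zd t t01).
    have h1 := fF m Bx; have h2 := fF m BhU; have h3 := fG m _ Bz.
    move: h1 h2 h3 Gz E; rewrite /=.
    set y := x + h *: delta_mx 0 k.
    move: (F x) (F y) (f m x) (f m y) (partial k (f m) _) (G x) (G _).
    move=> a b a' b' q g g' h1 h2 h3 h4 E.
    have -> : b - a - h * g = (b - b') + - (a - a') + h * (- (g' - q) - (g - g')).
      by move/eqP: E; rewrite subr_eq => /eqP ->; ring.
    rewrite -[X in _ <= _ + X]mulrA; set c := A / 2 ^+ m in h1 h2 h3 *.
    apply: (le_trans (ler_normD _ _)).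
    have e1 : `|b - b' + - (a - a')| <= c + c.
      by apply: (le_trans (ler_normD _ _)); rewrite normrN lerD.
    have e2 : `|h * (- (g' - q) - (g - g'))| <= `|h| * (c + e).
      rewrite normrM ler_wpM2l//; apply: (le_trans (ler_normD _ _)).
      by rewrite !normrN lerD// ltW.
    apply: (le_trans (lerD e1 e2)); rewrite mulrDr mulrDl; lra.
  have := le_half_pow key.
  rewrite [h *: delta_mx 0 k + x]addrC; set y := x + _.
  move: (F y) (F x) (G x) => b a g K.
  have -> : g - h^-1 *: (b - a) = - (h^-1 * (b - a - h * g)).
    by rewrite /GRing.scale /=; field.
  by rewrite normrN normrM normfV ler_pdivrMl ?normr_gt0.
by split; [apply/cvg_ex; eexists; exact: L|apply/cvg_lim => //; exact: L].
Unshelve. all: by end_near. Qed.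

End UniformLimit.

(** * Integrable linear systems *)

Section Primitive.
Context {R : realType} {n : nat}.
Variables (p : 'rV[R]_n) (r : R).
Implicit Types (w : 'I_n -> 'rV[R]_n -> R) (x : 'rV[R]_n).
Let B := ball p r.
Let oB : open B. Proof. exact: ball_open. Qed.

(** The radial primitive of the Poincaré lemma: the integral of the one-form [w] along the segment
    from [p] to [x]. *)
Definition primitive w x : R :=
  \sum_j (x 0 j - p 0 j) * ray_mean p 0 (w j) x.

Let smooth_dx (j : 'I_n) : smooth B (fun x => x 0 j - p 0 j).
Proof. by apply: smoothB => //; [exact: smooth_coord|exact: smooth_cst]. Qed.

Lemma smooth_primitive w : (forall j, smooth B (w j)) -> smooth B (primitive w).
Proof.
move=> sw; apply: smooth_sum => // j _; apply: smoothM => //.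
exact: smooth_ray_mean.
Qed.

Lemma primitive_center w : primitive w p = 0.
Proof. by rewrite /primitive big1// => j _; rewrite subrr mul0r. Qed.

Lemma ray_sum_bound a (f : 'I_n -> 'rV[R]_n -> R) x (C : R) :
  0 <= C -> (forall j, smooth B (f j)) -> B x ->
  (forall j y, B y -> `|f j y| <= C) ->
  `|\sum_j (x 0 j - p 0 j) * ray_mean p a (f j) x| <= n%:R * r * C.
Proof.
move=> C0 sf Bx fC; apply: (le_trans (ler_norm_sum _ _ _)).
rewrite -mulrA mulr_natl -[X in _ *+ X]card_ord -sumr_const.
apply: ler_sum => j _; rewrite normrM; apply: ler_pM => //; last first.
  exact: ray_mean_bound (fC j).
apply: (@le_trans _ _ `|x - p|); last by rewrite ltW// -ball_rVE.
by have := rV_coord_le (x - p) j; rewrite !mxE.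
Qed.

Lemma ray_meanB a f1 f2 x : smooth B f1 -> smooth B f2 -> B x ->
  ray_mean p a (fun y => f1 y - f2 y) x = ray_mean p a f1 x - ray_mean p a f2 x.
Proof.
move=> s1 s2 Bx; rewrite /ray_mean -int01B.
- by apply: eq_int01 => t _; rewrite mulrBr.
- exact: continuous01_ray s1 Bx.
- exact: continuous01_ray s2 Bx.
Qed.

(** The failure of the gradient to be [w] is a ray average of the curl of [w]. This quantitative
    form is needed because the right-hand sides met in Picard iteration are closed only in the
    limit. *)
Lemma partial_primitive w x k : (forall j, smooth B (w j)) -> B x ->
  partial k (primitive w) x = w k x +
  \sum_j (x 0 j - p 0 j) *
    ray_mean p 1 (fun y => partial k (w j) y - partial j (w k) y) x.
Proof.
move=> sw Bx.
have sr j := smooth_ray_mean 0 (sw j).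
rewrite /primitive (partial_sum k _ oB _ Bx); last by move=> j; apply: smoothM.
have E j : partial k (fun z => (z 0 j - p 0 j) * ray_mean p 0 (w j) z) x =
   (k == j)%:R * ray_mean p 0 (w j) x +
   (x 0 j - p 0 j) * ray_mean p 1 (partial k (w j)) x.
  rewrite (partialM k (smooth_dx j) (sr j) Bx).
  rewrite (partialB k (smooth_coord (U := B) j) (smooth_cst B (p 0 j)) Bx).
  rewrite partial_coord partial_cst subr0; congr (_ + _ * _).
  by have [_] := is_derive_ray_mean 0 k (sw j) Bx.
under eq_bigr do rewrite E.
rewrite big_split /= (bigD1 k)//= eqxx mul1r [X in _ + X + _]big1 ?addr0; last first.
  by move=> j jk; rewrite eq_sym (negbTE jk) mul0r.
rewrite -[in RHS](ray_mean_id (sw k) Bx) -addrA -big_split /=; congr (_ + _).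
apply: eq_bigr => j _; rewrite ray_meanB//; try exact: smooth_partial.
by rewrite mulrBr addrC subrK.
Qed.

Lemma primitive_closed w x k : (forall j, smooth B (w j)) ->
  (forall j k x, B x -> partial k (w j) x = partial j (w k) x) ->
  B x -> partial k (primitive w) x = w k x.
Proof.
move=> sw cw Bx; rewrite partial_primitive// big1 ?addr0// => j _.
suff : `|ray_mean p 1 (fun y => partial k (w j) y - partial j (w k) y) x| <= 0.
  by rewrite normr_le0 => /eqP ->; rewrite mulr0.
apply: (ray_mean_bound (r := r)) => //.
  by apply: smoothB => //; exact: smooth_partial.
by move=> y By; rewrite cw// subrr normr0.
Qed.

Lemma primitiveB w1 w2 x : (forall j, smooth B (w1 j)) -> (forall j, smooth B (w2 j)) ->
  B x -> primitive w1 x - primitive w2 x = primitive (fun j y => w1 j y - w2 j y) x.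
Proof.
move=> s1 s2 Bx; rewrite /primitive -sumrB; apply: eq_bigr => j _.
by rewrite ray_meanB// mulrBr.
Qed.

End Primitive.

(** * Picard iteration for a flat linear system on a small ball *)

Section LinearSystem.
Context {R : realType} {n N : nat}.
Variables (p : 'rV[R]_n) (r C : R).
Variable W : 'I_n -> 'I_N -> 'I_N -> 'rV[R]_n -> R.
Let B := ball p r.
Let oB : open B. Proof. exact: ball_open. Qed.
Hypothesis (r0 : 0 < r) (C0 : 0 <= C).
Hypothesis sW : forall k c b, smooth B (W k c b).
Hypothesis WC : forall k c b x, B x -> `|W k c b x| <= C.
(** Zero curvature, in the convention where the unknown row [v] is multiplied by [W] on the right:
    the two mixed derivatives of a solution, computed from the system, agree. *)
Hypothesis flatW : forall j k c b x, B x ->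
  partial j (W k c b) x + \sum_d W j c d x * W k d b x =
  partial k (W j c b) x + \sum_d W k c d x * W j d b x.
(** In [curlE] the increments have coefficients summing to at most [2 * (N%:R * C) ^+ 2] and the
    defects to at most [2 * (N%:R * C)]. Integration along a ray costs a further [n%:R * r], so [rK]
    halves the errors at each step. *)
Let K := 2 * (N%:R * C) ^+ 2 + 2 * (N%:R * C).
Hypothesis rK : n%:R * r * K <= 2^-1.

Variable v0 : 'I_N -> R.

Let rhs (v : 'I_N -> 'rV[R]_n -> R) (b : 'I_N) (k : 'I_n) x :=
  \sum_c v c x * W k c b x.

(** Starting from [0] makes the first right-hand side vanish: the first increment is the constant
    [v0] and the first defect is zero. *)
Fixpoint picard (m : nat) : 'I_N -> 'rV[R]_n -> R :=
  if m is m'.+1 then fun b x => v0 b + primitive p (rhs (picard m') b) x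
  else fun _ _ => 0.

Let smooth_rhs v b k : (forall c, smooth B (v c)) -> smooth B (rhs v b k).
Proof. by move=> sv; apply: smooth_sum => // c _; apply: smoothM. Qed.

Let smooth_picard m b : smooth B (picard m b).
Proof.
elim: m b => [|m IH] b /=; first exact: smooth_cst.
apply: smoothD => //; first exact: smooth_cst.
by apply: smooth_primitive => k; exact: smooth_rhs.
Qed.

(* How far the iterates are from solving the system; [ray_mean] turns it into an
   average of the curl of the right-hand side. *)
Let defect m b k x := partial k (picard m.+1 b) x - rhs (picard m) b k x.

Let curl m b k j y := partial k (rhs (picard m) b j) y - partial j (rhs (picard m) b k) y.

Let smooth_curl m b k j : smooth B (curl m b k j).
Proof. by apply: smoothB => //; apply: smooth_partial; exact: smooth_rhs. Qed.

Let defectE m b k x : B x -> defect m b k x =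
  \sum_j (x 0 j - p 0 j) * ray_mean p 1 (curl m b k j) x.
Proof.
move=> Bx; rewrite /defect /=.
have sr k' : smooth B (rhs (picard m) b k') by exact: smooth_rhs.
rewrite (partialD k (smooth_cst B (v0 b)) (smooth_primitive sr) Bx) partial_cst add0r.
by rewrite (partial_primitive k sr Bx) addrC addKr.
Qed.

(* Flatness of [W] makes the curl of the right-hand side linear in the last
   increment and in the previous defect, so that both decay geometrically. *)
Let curlE m b k j y : B y -> curl m.+1 b k j y =
  \sum_c (picard m.+1 c y - picard m c y) *
    (\sum_d (W j c d y * W k d b y - W k c d y * W j d b y)) +
  \sum_c (defect m c k y * W j c b y - defect m c j y * W k c b y).
Proof.
move=> By.
have E k' j' : partial k' (rhs (picard m.+1) b j') y =
  \sum_c ((defect m c k' y + rhs (picard m) c k' y) * W j' c b y +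
    picard m.+1 c y * partial k' (W j' c b) y).
  rewrite /rhs (partial_sum k' _ oB _ By); last by move=> c; apply: smoothM.
  apply: eq_bigr => c _; rewrite (partialM k' (smooth_picard m.+1 c) (sW j' c b) By).
  by rewrite /defect subrK.
rewrite /curl !E -sumrB -big_split /=.
(* Substituting the previous right-hand sides produces a commutator of the matrices [W] acting on
   [picard m]. By flatness the curl of [W] gives the opposite commutator acting on [picard m.+1], so
   only the increment survives. *)
have S : \sum_c (rhs (picard m) c k y * W j c b y - rhs (picard m) c j y * W k c b y)
   = \sum_c picard m c y * \sum_d (W k c d y * W j d b y - W j c d y * W k d b y).
  have S1 k' j' : \sum_c rhs (picard m) c k' y * W j' c b y =
     \sum_c \sum_d picard m c y * (W k' c d y * W j' d b y).
    rewrite exchange_big /=; apply: eq_bigr => c _; rewrite /rhs mulr_suml.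
    by apply: eq_bigr => d _; rewrite mulrA.
  rewrite sumrB !S1 -sumrB; apply: eq_bigr => c _.
  by rewrite -sumrB mulr_sumr; apply: eq_bigr => d _; rewrite mulrBr.
have D c : partial k (W j c b) y - partial j (W k c b) y =
   \sum_d (W j c d y * W k d b y - W k c d y * W j d b y).
  have := flatW j k c b By; rewrite sumrB.
  move: (partial _ _ _) (partial _ _ _) (\sum_d _) (\sum_d _) => a1 a2 a3 a4.
  by move/eqP; rewrite -subr_eq => /eqP <-; ring.
have DN c : \sum_d (W k c d y * W j d b y - W j c d y * W k d b y) =
   - (partial k (W j c b) y - partial j (W k c b) y).
  by rewrite D -sumrN; apply: eq_bigr => d _; rewrite opprB.
transitivity (\sum_c (rhs (picard m) c k y * W j c b y - rhs (picard m) c j y * W k c b y)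
  + \sum_c (picard m.+1 c y * (partial k (W j c b) y - partial j (W k c b) y)
   + (defect m c k y * W j c b y - defect m c j y * W k c b y))).
  rewrite -big_split /=; apply: eq_bigr => c _.
  move: (rhs _ _ _ _) (rhs _ _ _ _) (defect _ _ _ _) (defect _ _ _ _) => a1 a2 a3 a4.
  move: (W _ _ _ _) (W _ _ _ _) (partial _ _ _) (partial _ _ _) (primitive _ _ _) => a5 a6 a7 a8 a9.
  ring.
rewrite S -big_split /=; apply: eq_bigr => c _.
rewrite -D DN.
move: (defect _ _ _ _) (defect _ _ _ _) => a3 a4.
move: (W _ _ _ _) (W _ _ _ _) (partial _ _ _) (partial _ _ _) (primitive _ _ _) (picard _ _ _) => a5 a6 a7 a8 a9 a10.
ring.
Qed.

Let sum_bound (F : 'I_N -> R) (c : R) : (forall i, `|F i| <= c) ->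
  `|\sum_i F i| <= N%:R * c.
Proof.
move=> Fc; apply: (le_trans (ler_norm_sum _ _ _)).
rewrite mulr_natl -[X in _ *+ X]card_ord -sumr_const.
by apply: ler_sum.
Qed.

Let A := \sum_b `|v0 b|.
Let A0 : 0 <= A. Proof. exact: sumr_ge0. Qed.

Let NC0 : 0 <= N%:R * C. Proof. by rewrite mulr_ge0. Qed.
Let K0 : 0 <= K.
Proof. by rewrite addr_ge0// mulr_ge0// exprn_ge0. Qed.

Let half_step (X : R) : 0 <= X -> n%:R * r * (K * X) <= X / 2.
Proof. by move=> X0; rewrite mulrA [X / 2]mulrC ler_wpM2r. Qed.

(** The two bounds need a joint induction: the new defect is an average of a curl involving both the
    last increment and the previous defect. The constant [A] bounds the first increment [v0]. *)
Lemma picard_bounds m :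
  (forall b x, B x -> `|picard m.+1 b x - picard m b x| <= A / 2 ^+ m) /\
  (forall b k x, B x -> `|defect m b k x| <= A / 2 ^+ m).
Proof.
elim: m => [|m [IH1 IH2]].
  have r0z b k : rhs (picard 0) b k = fun=> 0.
    by apply/funext => x; rewrite /rhs big1// => c _; rewrite mul0r.
  rewrite expr0 divr1; split=> [b x Bx|b k x Bx].
    rewrite /= subr0; suff -> : primitive p (rhs (picard 0) b) x = 0.
      by rewrite addr0 /A (bigD1 b)//= lerDl sumr_ge0.
    have := @ray_sum_bound R n p r 0 (rhs (picard 0) b) x 0 (lexx 0).
    rewrite mulr0 normr_le0 => H; apply/eqP; apply: H => //.
      by move=> j; exact: smooth_rhs.
    by move=> j y _; rewrite r0z normr0.
  rewrite defectE//.
  apply: (@le_trans _ _ (n%:R * r * 0)); last by rewrite mulr0.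
  apply: ray_sum_bound => // j y By.
  by rewrite /curl !r0z !partial_cst subrr normr0.
set X := A / 2 ^+ m in IH1 IH2.
have X0 : 0 <= X by rewrite divr_ge0// exprn_ge0.
have XE : A / 2 ^+ m.+1 = X / 2 by rewrite exprSr invfM mulrA.
rewrite XE.
have S1 : N%:R * C <= K.
  by rewrite /K; move: (exprn_ge0 2 NC0) NC0; move: (N%:R * C) => t; lra.
split=> [b x Bx|b k x Bx].
  have sr m' k : smooth B (rhs (picard m') b k) by exact: smooth_rhs.
  have -> : picard m.+2 b x - picard m.+1 b x =
      primitive p (fun k y => rhs (picard m.+1) b k y - rhs (picard m) b k y) x.
    by rewrite -(primitiveB (sr m.+1) (sr m) Bx) /= opprD addrACA subrr add0r.
  apply: le_trans (half_step X0).
  apply: ray_sum_bound => //; first by rewrite mulr_ge0.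
    by move=> j; apply: smoothB.
  move=> j y By; rewrite /rhs -sumrB.
  apply: (@le_trans _ _ (N%:R * (X * C))).
    apply: sum_bound => c; rewrite -mulrBl normrM.
    by apply: ler_pM => //; [exact: IH1|exact: WC].
  by rewrite [X * C]mulrC mulrA ler_wpM2r.
rewrite defectE//; apply: le_trans (half_step X0).
apply: ray_sum_bound => //; first by rewrite mulr_ge0.
move=> j y By; rewrite curlE//.
apply: (le_trans (ler_normD _ _)).
have WW k' j' c d : `|W j' c d y * W k' d b y| <= C * C.
  by rewrite normrM; apply: ler_pM => //; exact: WC.
have DW k' j' c : `|defect m c k' y * W j' c b y| <= X * C.
  by rewrite normrM; apply: ler_pM => //; [exact: IH2|exact: WC].
have T1 : `|\sum_c (picard m.+1 c y - picard m c y) *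
    (\sum_d (W j c d y * W k d b y - W k c d y * W j d b y))| <=
    N%:R * (X * (N%:R * (C * C + C * C))).
  apply: sum_bound => c; rewrite normrM; apply: ler_pM => //; first exact: IH1.
  by apply: sum_bound => d; apply: (le_trans (ler_normB _ _)); exact: lerD.
have T2 : `|\sum_c (defect m c k y * W j c b y - defect m c j y * W k c b y)|
   <= N%:R * (X * C + X * C).
  by apply: sum_bound => c; apply: (le_trans (ler_normB _ _)); exact: lerD.
apply: (le_trans (lerD T1 T2)); rewrite /K; by rewrite le_eqVlt; apply/orP; left; apply/eqP; ring.
Qed.

(** Since the defects tend to zero uniformly, the partial derivatives of the iterates converge to
    the right-hand side of the limit, in all directions and not only radially. Smoothness follows by
    the bootstrap. *)
Lemma linear_system_ball : exists v : 'I_N -> 'rV[R]_n -> R,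
  [/\ forall b, smooth B (v b), forall b, v b p = v0 b &
    forall b k x, B x -> partial k (v b) x = \sum_c v c x * W k c b x].
Proof.
have H (bx : 'I_N * 'rV[R]_n) : exists l, B bx.2 ->
    forall m, `|l - picard m bx.1 bx.2| <= 2 * A / 2 ^+ m.
  have [Bx|nBx] := pselect (B bx.2); last by exists 0.
  have [|l lP] := @halving_limit R (fun m => picard m bx.1 bx.2) A.
    by move=> m; exact: (picard_bounds m).1.
  by exists l.
have [v' vP'] := choice H.
pose v b x := v' (b, x).
have vP b m x : B x -> `|v b x - picard m b x| <= 2 * A / 2 ^+ m.
  by move=> Bx; exact: (vP' (b, x)).
have cv b x : B x -> {for x, continuous (v b)}.
  move=> Bx; apply: (uniform_limit_continuous (vP b) Bx) => m.
  exact: smooth_continuous (smooth_picard m b) Bx.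
have crhs b k x : B x -> {for x, continuous (rhs v b k)}.
  move=> Bx; suff : rhs v b k z @[z --> x] --> rhs v b k x by [].
  apply: cvg_big; [exact: add_continuous|exact: nbhs_filter|move=> c _].
  by exact: (cvgM (cv c x Bx) (smooth_continuous (sW k c b) Bx)).
(* The first term pays for replacing [v] by [picard m] in the right-hand side; [2 * A] covers both
   the defect and the distance from the iterate to the limit. *)
pose A' := N%:R * (2 * A * C) + 2 * A.
have A'0 : 0 <= A' by rewrite /A' addr_ge0 ?mulr_ge0.
have dv b k x : B x -> is_derive x (delta_mx 0 k) (v b) (rhs v b k x).
  move=> Bx.
  (* The sequence is shifted because the defect compares the derivative of [picard m.+1] with the
     right-hand side of [picard m]. *)
  apply: (@uniform_limit_derive R n p r A' (fun m => picard m.+1 b)) => //.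
  - move=> m y By; apply: (le_trans (vP b m.+1 y By)).
    rewrite exprS invfM mulrA ler_wpM2r ?invr_ge0 ?exprn_ge0//.
    have : 0 <= N%:R * (2 * A * C) by rewrite !mulr_ge0.
    rewrite /A'; move: A0 (N%:R * (2 * A * C)) => ? ? ?; lra.
  - by move=> m z Bz; exact: smooth_derivable (smooth_picard m.+1 b) Bz.
  - move=> m z Bz.
    have -> : rhs v b k z - partial k (picard m.+1 b) z =
       \sum_c (v c z - picard m c z) * W k c b z - defect m b k z.
      have -> : \sum_c (v c z - picard m c z) * W k c b z =
          rhs v b k z - rhs (picard m) b k z.
        by rewrite /rhs -sumrB; apply: eq_bigr => c _; rewrite mulrBl.
      by rewrite /defect opprB addrA subrK.
    apply: (le_trans (ler_normB _ _)).
    apply: (@le_trans _ _ (N%:R * (2 * A / 2 ^+ m * C) + A / 2 ^+ m)).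
      apply: lerD; last exact: (picard_bounds m).2.
      apply: sum_bound => c; rewrite normrM.
      by apply: ler_pM => //; [exact: vP|exact: WC].
    have q0 : 0 <= (2 ^+ m)^-1 :> R by rewrite invr_ge0 exprn_ge0.
    have : 0 <= A / 2 ^+ m by rewrite mulr_ge0.
    by rewrite /A'; move: ((2 ^+ m)^-1) => q; rewrite mulrDl; lra.
  - exact: crhs.
exists v; split; last 1 first.
- by move=> b k x Bx; have [_] := dv b k x Bx.
- apply: smooth_system => // [b k x Bx|m cm b k]; first by have [] := dv b k x Bx.
  refine (eq_Ck oB _ (_ : Ck B m (rhs v b k))) => [x /set_mem Bx|].
    by have [_ <-] := dv b k x Bx.
  apply: Ck_sum => // c _; apply: CkM => //.
  by have /smoothP := sW k c b.
move=> b; apply/eqP; rewrite -subr_eq0 -normr_le0.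
apply: (@le_half_pow _ _ _ A) => m; rewrite add0r.
have Bp : B p by exact: ballxx.
have := vP b m.+1 p Bp; rewrite /= primitive_center addr0 exprS invfM mulrA.
by rewrite [2 * A]mulrC mulfK.
Qed.

End LinearSystem.

Section LocalSystems.
Context {R : realType} {n : nat}.
Implicit Types (U : set 'rV[R]_n) (p x : 'rV[R]_n).

(** The radius is fixed before the initial value, so that solutions for several initial values live
    on a common ball. *)
Lemma linear_system (N : nat) U p (W : 'I_n -> 'I_N -> 'I_N -> 'rV[R]_n -> R) :
  open U -> U p -> (forall k c b, smooth U (W k c b)) ->
  (forall j k c b x, U x ->
    partial j (W k c b) x + \sum_d W j c d x * W k d b x =
    partial k (W j c b) x + \sum_d W k c d x * W j d b x) ->
  exists r : R, [/\ 0 < r, ball p r `<=` U &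
    forall v0 : 'I_N -> R, exists v : 'I_N -> 'rV[R]_n -> R,
    [/\ forall b, smooth (ball p r) (v b), forall b, v b p = v0 b &
      forall b k x, ball p r x ->
        partial k (v b) x = \sum_c v c x * W k c b x]].
Proof.
move=> oU Up sW fW.
have [|r [C [r0 C0 rU WC]]] := @locally_bounded R n U p ('I_n * 'I_N * 'I_N)%type
  (fun i => W i.1.1 i.1.2 i.2) oU Up.
  by move=> i; exact: smooth_continuous (sW _ _ _) Up.
pose K := 2 * (N%:R * C) ^+ 2 + 2 * (N%:R * C).
have K0 : 0 <= K by rewrite addr_ge0// mulr_ge0// ?exprn_ge0// mulr_ge0.
have nK0 : 0 <= n%:R * K by rewrite mulr_ge0.
(* Small enough for [n%:R * s * K] to be at most one half; the added [1] keeps the denominator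
   positive. *)
pose s := Num.min r (2^-1 / (n%:R * K + 1)).
have s0 : 0 < s by rewrite lt_min r0 divr_gt0// ltr_wpDl.
have sr : ball p s `<=` ball p r by apply: sub_ball; rewrite ge_min lexx.
have sU := subset_trans sr rU.
have sK : n%:R * s * K <= 2^-1.
  rewrite mulrAC; apply: (@le_trans _ _ ((n%:R * K + 1) * (2^-1 / (n%:R * K + 1)))).
    by apply: ler_pM => //; [exact: ltW|rewrite lerDl|rewrite ge_min lexx orbT].
  by rewrite mulrC divfK// gt_eqF// ltr_wpDl.
exists s; split=> // v0.
apply: (linear_system_ball s0 C0 _ _ _ sK) => //.
- by move=> k c b; exact: smooth_sub sU (sW k c b).
- by move=> k c b x /sr Bx; exact: (WC (k, c, b)).
- by move=> j k c b x /sU; exact: fW.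
Qed.

(* The hypothesis on [h] is the growth condition of a linear system, stated
   without naming the coefficients. *)
Lemma linear_system_zero (I : finType) U p (h : I -> 'rV[R]_n -> R) (L : R) :
  open U -> U p -> (forall b, smooth U (h b)) -> (forall b, h b p = 0) -> 0 <= L ->
  (forall x M, U x -> (forall b, `|h b x| <= M) ->
     forall b k, `|partial k (h b) x| <= L * M) ->
  exists r : R, [/\ 0 < r, ball p r `<=` U &
    forall b x, ball p r x -> h b x = 0].
Proof.
move=> oU Up sh hp L0 hL.
have [|r [C [r0 C0 rU hC]]] := @locally_bounded R n U p I h oU Up.
  by move=> b; exact: smooth_continuous (sh b) Up.
have nL0 : 0 <= n%:R * L by rewrite mulr_ge0.
pose s := Num.min r (2^-1 / (n%:R * L + 1)).
have s0 : 0 < s by rewrite lt_min r0 divr_gt0// ltr_wpDl.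
have sr : ball p s `<=` ball p r by apply: sub_ball; rewrite ge_min lexx.
have sU := subset_trans sr rU.
have sL : n%:R * L * s <= 2^-1.
  apply: (@le_trans _ _ ((n%:R * L + 1) * (2^-1 / (n%:R * L + 1)))).
    by apply: ler_pM => //; [exact: ltW|rewrite lerDl|rewrite ge_min lexx orbT].
  by rewrite mulrC divfK// gt_eqF// ltr_wpDl.
exists s; split=> //.
(* Each use of the mean value inequality from [p], where [h] vanishes, halves the bound on the
   ball. *)
have H m : forall b x, ball p s x -> `|h b x| <= C / 2 ^+ m.
  elim: m => [|m IH] b x sx; first by rewrite expr0 divr1; apply: hC; exact: sr.
  rewrite -[h b x]subr0 -(hp b).
  have X0 : 0 <= C / 2 ^+ m by rewrite mulr_ge0// invr_ge0 exprn_ge0.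
  apply: (le_trans (@derivative_bound R n p s (L * (C / 2 ^+ m)) (h b) p x
    (smooth_sub sU (sh b)) _ (ballxx _ s0) sx)).
    by move=> i z sz; apply: hL; [exact: sU|move=> c; exact: IH].
  rewrite exprS invfM [leRHS]mulrCA.
  apply: (@le_trans _ _ (n%:R * L * s * (C / 2 ^+ m))); last exact: ler_wpM2r.
  rewrite mulrA [leRHS]mulrAC ler_wpM2l//; first exact: mulr_ge0.
  by rewrite ltW// -ball_rVE.
move=> b x sx; apply/eqP; rewrite -normr_le0.
by apply: (@le_half_pow _ _ _ C) => m; rewrite add0r; exact: H.
Qed.

End LocalSystems.

(** * The inverse function theorem *)

Section SmoothMatrix.
Context {R : realType} {n : nat}.
Implicit Types (U : set 'rV[R]_n).

Definition smooth_mx (a b : nat) U (A : 'rV[R]_n -> 'M[R]_(a, b)) :=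
  forall i j, smooth U (fun x => A x i j).

Lemma smooth_mx_cst (a b : nat) U (A : 'M[R]_(a, b)) : smooth_mx U (fun=> A).
Proof. by move=> i j; exact: smooth_cst. Qed.

Lemma smooth_mx_tr (a b : nat) U (A : 'rV[R]_n -> 'M[R]_(a, b)) : open U ->
  smooth_mx U A -> smooth_mx U (fun x => (A x)^T).
Proof.
by move=> oU sA i j; refine (eq_smooth oU _ (sA j i)) => x _; rewrite mxE.
Qed.

Lemma smooth_mxM (a b c : nat) U (A : 'rV[R]_n -> 'M[R]_(a, b))
    (B : 'rV[R]_n -> 'M[R]_(b, c)) : open U ->
  smooth_mx U A -> smooth_mx U B -> smooth_mx U (fun x => A x *m B x).
Proof.
move=> oU sA sB i j.
refine (eq_smooth oU _ (_ : smooth U (fun x => \sum_k A x i k * B x k j))).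
  by move=> x _; rewrite mxE.
by apply: smooth_sum => // k _; exact: smoothM.
Qed.

Lemma smooth_mxB (a b : nat) U (A B : 'rV[R]_n -> 'M[R]_(a, b)) : open U ->
  smooth_mx U A -> smooth_mx U B -> smooth_mx U (fun x => A x - B x).
Proof.
move=> oU sA sB i j; refine (eq_smooth oU _ (smoothB oU (sA i j) (sB i j))).
by move=> x _; rewrite !mxE.
Qed.

Lemma smooth_det (a : nat) U (A : 'rV[R]_n -> 'M[R]_a) : open U ->
  smooth_mx U A -> smooth U (fun x => \det (A x)).
Proof.
move=> oU sA; apply: smooth_sum => // s _; apply: smoothM => //.
  exact: smooth_cst.
by apply: smooth_prod.
Qed.

Lemma smooth_invmx (a : nat) U (A : 'rV[R]_n -> 'M[R]_a) : open U ->
  (forall x, U x -> A x \in unitmx) ->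
  smooth_mx U A -> smooth_mx U (fun x => invmx (A x)).
Proof.
move=> oU uA sA i j.
refine (eq_smooth oU _ (_ : smooth U (fun x => (\det (A x))^-1 *
  ((-1) ^+ (j + i) * \det (row' j (col' i (A x))))))).
  by move=> x /set_mem Ux; rewrite /invmx uA// !mxE.
apply: smoothM => //.
  apply: smoothV => //; last exact: smooth_det.
  by move=> x Ux; have := uA x Ux; rewrite unitmxE unitfE.
apply: smoothM => //; first exact: smooth_cst.
apply: smooth_det => // k l; refine (eq_smooth oU _ (sA (lift j k) (lift i l))).
by move=> x _; rewrite !mxE.
Qed.

End SmoothMatrix.

Section InverseFunction.
Context {R : realType} {n : nat}.

(** The row index is the variable of differentiation, so this is the transpose of the usual Jacobian
    matrix and the chain rule multiplies in the order of composition. *)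
Definition jac (y : 'rV[R]_n -> 'rV[R]_n) (z : 'rV[R]_n) : 'M[R]_n :=
  \matrix_(i, j) partial i (fun w => y w 0 j) z.

Lemma smooth_jac (U : set 'rV[R]_n) y : open U -> smooth_map U y ->
  smooth_mx U (jac y).
Proof.
move=> oU sy i j; refine (eq_smooth oU _ (smooth_partial i (sy j))).
by move=> x _; rewrite mxE.
Qed.

Lemma coordinates_jac (V : set 'rV[R]_n) (y x : 'rV[R]_n -> 'rV[R]_n) z :
  coordinates V y x -> V z -> jac y z *m jac x (y z) = 1%:M.
Proof.
move=> [oV oyV sy sx yx] Vz; apply/matrixP => i j; rewrite !mxE.
have Yz : (y @` V) (y z) by exists z.
have := @partial_comp R n n (y @` V) (fun w => x w 0 j) y z i oyV (sx j) Yz.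
rewrite -(@eq_partial R n V (fun w => w 0 j) _ z i oV Vz); last first.
  by move=> w Vw; rewrite /= yx.
rewrite partial_coord => ->; last by move=> k; exact: smooth_derivable (sy k) Vz.
by apply: eq_bigr => k _; rewrite !mxE mulrC.
Qed.

Let half_lipschitz (B : set 'rV[R]_n) (psi : 'rV[R]_n -> 'rV[R]_n) :=
  forall z w, B z -> B w -> `|psi z - psi w| <= `|z - w| / 2.

(** A fixed point of the contraction [T], which sends [w] to [q - psi w]. The iterates from [z0]
    stay within twice the initial displacement, hence in the ball of radius [s]. *)
Lemma half_lipschitz_solve (B : set 'rV[R]_n) psi z0 q (s : R) :
  half_lipschitz B psi -> ball z0 s `<=` B ->
  2 * `|q - (z0 + psi z0)| < s -> exists2 w, ball z0 s w & w + psi w = q.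
Proof.
move=> psiL sB; set A := `|_| => As.
have A0 : 0 <= A by exact: normr_ge0.
pose T w := q - psi w.
have T0 : `|T z0 - z0| = A by rewrite /T /A opprD addrA addrAC.
have inB w : `|w - z0| <= 2 * A -> ball z0 s w.
  by move=> wA; rewrite ball_rVE; exact: le_lt_trans As.
have Bz0 : B z0 by apply/sB/inB; rewrite subrr normr0 mulr_ge0.
have TL w w' : B w -> B w' -> `|T w - T w'| <= `|w - w'| / 2.
  move=> Bw Bw'; rewrite /T opprB addrC addrA subrK.
  by rewrite (distrC w); exact: psiL.
have TA w : `|w - z0| <= 2 * A -> `|T w - z0| <= 2 * A.
  move=> wA; have Bw := sB _ (inB _ wA).
  have -> : T w - z0 = (T w - T z0) + (T z0 - z0) by rewrite addrA subrK.
  apply: (le_trans (ler_normD _ _)); rewrite T0.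
  have := TL _ _ Bw Bz0; lra.
pose u m := iter m T z0.
have uA m : `|u m - z0| <= 2 * A.
  by elim: m => [|m IH]; [rewrite subrr normr0 mulr_ge0|exact: TA].
have uS m : `|u m.+1 - u m| <= A / 2 ^+ m.
  elim: m => [|m IH]; first by rewrite expr0 divr1 -T0.
  apply: (le_trans (TL (u m.+1) (u m) (sB _ (inB _ (uA m.+1))) (sB _ (inB _ (uA m))))).
  by rewrite exprSr invfM mulrA ler_wpM2r.
have H (j : 'I_n) : exists l, forall m, `|l - u m 0 j| <= 2 * A / 2 ^+ m.
  apply: halving_limit => m; apply: le_trans (uS m).
  by have := rV_coord_le (u m.+1 - u m) j; rewrite !mxE.
have [l lP] := choice H.
pose w : 'rV[R]_n := \row_j l j.
have wu m : `|w - u m| <= 2 * A / 2 ^+ m.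
  apply: rV_norm_le => [|j]; last by rewrite !mxE.
  by rewrite mulr_ge0 ?mulr_ge0// invr_ge0 exprn_ge0.
have wA : `|w - z0| <= 2 * A by have := wu 0%N; rewrite expr0 divr1.
exists w; first exact: inB.
suff Tw : `|T w - w| <= 0.
  move: Tw; rewrite normr_le0 subr_eq0 /T => /eqP E.
  by rewrite -[X in X + _]E subrK.
apply: (@le_half_pow _ _ _ (2 * A)) => m; rewrite add0r.
have -> : T w - w = (T w - T (u m)) - (w - u m.+1).
  have -> : u m.+1 = T (u m) by [].
  by move: (T w) (T (u m)) => a b; rewrite opprB addrA subrK.
have h1 := TL _ _ (sB _ (inB _ wA)) (sB _ (inB _ (uA m))).
have h2 := wu m; have h3 := wu m.+1.
apply: (le_trans (ler_normB _ _)).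
rewrite exprSr invfM mulrA in h3; move: h1 h2 h3.
set c := 2 * A / 2 ^+ m; lra.
Qed.

(** On a ball where the Jacobian matrix is close to the identity, [y] is the identity plus a map
    [psi] with Lipschitz constant one half. Hence [y] is injective, its inverse is Lipschitz with
    constant [2], and its image is open by [half_lipschitz_solve]; the ball itself serves as [V]. *)
Lemma local_inverse (U : set 'rV[R]_n) (p : 'rV[R]_n) y : open U -> U p ->
  smooth_map U y -> jac y p = 1%:M ->
  exists (V : set 'rV[R]_n) x, [/\ V p, V `<=` U & coordinates V y x].
Proof.
move=> oU Up sy Jp.
have sJ := smooth_jac oU sy.
(* The Lipschitz bound for [psi] loses a factor [n]; this [c] makes [n%:R * c] at most one half, and
   the added [1] covers [n = 0]. *)
pose c : R := 2^-1 / (n%:R + 1).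
have n1 : 0 < n%:R + 1 :> R by rewrite ltr_wpDl.
have c0 : 0 < c by rewrite divr_gt0.
have nc : n%:R * c <= 2^-1.
  apply: (@le_trans _ _ ((n%:R + 1) * c)); first by rewrite ler_wpM2r ?lerDl// ltW.
  by rewrite /c mulrC divfK// gt_eqF.
pose f (ij : 'I_n * 'I_n) z := jac y z ij.1 ij.2 - (ij.1 == ij.2)%:R.
have [r [r0 rU rdet rf]] : exists r : R, [/\ 0 < r, ball p r `<=` U,
    forall z, ball p r z -> jac y z \in unitmx &
    forall z, ball p r z -> forall ij, `|f ij z| < c].
  have N1 : \forall z \near p, `|\det (jac y p) - \det (jac y z)| < 1.
    by move: (smooth_continuous (smooth_det oU sJ) Up) => /cvgrPdist_lt; apply.
  have N2 ij : \forall z \near p, `|jac y p ij.1 ij.2 - jac y z ij.1 ij.2| < c.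
    by move: (smooth_continuous (sJ ij.1 ij.2) Up) => /cvgrPdist_lt; apply.
  have N3 := filter_forall (nbhs_filter p) N2.
  have nU : nbhs p U by exact: open_nbhs_nbhs.
  have : nbhs p (U `&` ([set z | `|\det (jac y p) - \det (jac y z)| < 1] `&`
    [set z | forall ij, `|jac y p ij.1 ij.2 - jac y z ij.1 ij.2| < c])).
    exact: filterI nU (filterI N1 N3).
  move=> /nbhs_ballP[r /= r0 rP]; exists r; split=> //.
  - by move=> z /rP[].
  - move=> z /rP[_ [+ _]]; rewrite Jp det1 unitmxE unitfE.
    by apply: contraTneq => ->; rewrite subr0 normr1 ltxx.
  - by move=> z /rP[_ [_ +]] ij => /(_ ij); rewrite Jp /f !mxE distrC.
pose B := ball p r.
have oB : open B by exact: ball_open.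
have syB : smooth_map B y by move=> j; exact: smooth_sub rU (sy j).
pose psi z := y z - z.
have psiK z : z + psi z = y z by rewrite /psi addrC subrK.
have psiL : half_lipschitz B psi.
  move=> z w Bz Bw; apply: rV_norm_le => [|j]; first by rewrite divr_ge0.
  rewrite !mxE.
  pose g z := y z 0 j - z 0 j.
  have sg : smooth B g by exact: (smoothB oB (syB j) (smooth_coord (U := B) j)).
  apply: (le_trans (@derivative_bound R n p r c g w z sg _ Bw Bz)).
    move=> i v Bv; apply: ltW; have := rf v Bv (i, j); rewrite /f /= mxE.
    by rewrite (partialB i (syB j) (smooth_coord (U := B) j) Bv) partial_coord.
  by rewrite [leRHS]mulrC ler_wpM2r.
have expand z w : B z -> B w -> `|z - w| <= 2 * `|y z - y w|.
  move=> Bz Bw; have := psiL z w Bz Bw.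
  have -> : z - w = (y z - y w) - (psi z - psi w).
    by rewrite /psi !opprD !opprK addrACA -!addrA !addKr addrA addrN add0r.
  move: (y z - y w) (psi z - psi w) => a b H.
  have := ler_normB a b; lra.
have inj z w : B z -> B w -> y z = y w -> z = w.
  move=> Bz Bw E; have := expand z w Bz Bw; rewrite E subrr normr0 mulr0.
  by rewrite normr_le0 subr_eq0 => /eqP.
have oyB : open (y @` B).
  rewrite openE => _ [z0 Bz0 <-].
  have [s s0 sB] := open_ball_sub oB Bz0.
  apply/nbhs_ballP; exists (s / 2) => /=; first by rewrite divr_gt0.
  move=> q; rewrite ball_rVE => qs.
  have [|w zw E] := @half_lipschitz_solve B psi z0 q s psiL sB.
    by rewrite psiK mulrC -ltr_pdivlMr.
  by exists w; [exact: sB|rewrite -E psiK].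
(* Outside the image the inverse takes the default value [p]. *)
pose x q := xget p [set w | B w /\ y w = q].
have xP q : (y @` B) q -> B (x q) /\ y (x q) = q.
  move=> [w Bw E]; rewrite /x.
  by have := @xgetPex _ p [set w | B w /\ y w = q]; apply; exists w.
have xy z : B z -> x (y z) = z.
  by move=> Bz; have [|Bx E] := xP (y z); [exists z|exact: inj].
have xL q q' : (y @` B) q -> (y @` B) q' -> `|x q - x q'| <= 2 * `|q - q'|.
  move=> /xP[b1 e1] /xP[b2 e2]; have := expand _ _ b1 b2.
  by rewrite e1 e2.
exists B, x; split=> //; first exact: ballxx.
have cx q : (y @` B) q -> {for q, continuous x}.
  move=> Yq; suff : x z @[z --> q] --> x q by [].
  apply/(@cvgrPdist_lt _ _ _ (nbhs q) (nbhs_filter q)) => e e0.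
  have nY : nbhs q (y @` B) by exact: open_nbhs_nbhs.
  have nb : nbhs q (ball q (e / 2)) by apply: nbhsx_ballx; rewrite divr_gt0.
  apply: filterS (filterI nY nb) => q' /= [Yq' bq'].
  apply: (le_lt_trans (xL _ _ Yq Yq')).
  by rewrite distrC mulrC -ltr_pdivlMr// -ball_rVE.
have dx q a j : (y @` B) q ->
    is_derive q (delta_mx 0 a) (fun q => x q 0 j) (invmx (jac y (x q)) a j).
  move=> Yq; have [Bz yz] := xP q Yq; set z := x q in Bz yz *.
  pose Q := invmx (jac y z).
  pose cQ := \sum_k `|Q k j|.
  have L : h^-1 *: (x (h *: delta_mx 0 a + q) 0 j - x q 0 j) @[h --> 0^'] --> Q a j.
    apply/cvgrPdist_le => e e0.
    (* Chosen so that the final error [d * (2 * n%:R * cQ)] is at most [e]: the factor [2] is the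
       Lipschitz constant of the inverse, [n] counts the coordinates and [cQ] sums a column of the
       inverse matrix. *)
    pose d := e / (2 * n%:R * cQ + 1).
    have D0 : 0 < 2 * n%:R * cQ + 1.
      by rewrite ltr_wpDl// mulr_ge0// sumr_ge0.
    have d0 : 0 < d by rewrite divr_gt0.
    have N2 ij : \forall w \near z, `|jac y z ij.1 ij.2 - jac y w ij.1 ij.2| < d.
      by move: (smooth_continuous (sJ ij.1 ij.2) (rU _ Bz)) => /cvgrPdist_lt; apply.
    have : nbhs z [set w | forall ij, `|jac y z ij.1 ij.2 - jac y w ij.1 ij.2| < d].
      exact: filter_forall (nbhs_filter z) N2.
    move=> /nbhs_ballP[s /= s0 sP].
    have [t t0 tY] := open_ball_sub oyB Yq.
    near=> h.
    have hn0 : h != 0 by near: h; exact: nbhs_dnbhs_neq.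
    have ht : `|h| < t by near: h; exact: dnbhs0_lt.
    have hs : `|h| < s / 2 by near: h; apply: dnbhs0_lt; rewrite divr_gt0.
    have nh : `|h *: (delta_mx 0 a : 'rV[R]_n)| <= `|h|.
      rewrite normrZ; apply: (@le_trans _ _ (`|h| * 1)); last by rewrite mulr1.
      by rewrite ler_wpM2l//; exact: norm_delta_le.
    set q' := h *: delta_mx 0 a + q.
    have qq' : q' - q = h *: delta_mx 0 a by rewrite addrK.
    have Yq' : (y @` B) q'.
      by apply: tY; rewrite ball_rVE qq'; exact: le_lt_trans ht.
    have [Bw yw] := xP q' Yq'; set w := x q' in Bw yw *.
    have wz : `|w - z| <= 2 * `|h|.
      by apply: (le_trans (xL _ _ Yq' Yq)); rewrite qq' ler_wpM2l.
    (* The increment of [y] is the increment of its argument times a matrix of mean values close to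
       [jac y z]. Multiplying by the inverse [Q] of [jac y z] then gives the difference quotient of
       the inverse map. *)
    have Hm k : exists M : 'I_n -> R, (forall i, `|jac y z i k - M i| < d) /\
        y w 0 k - y z 0 k = \sum_i M i * (w 0 i - z 0 i).
      have [|ze [zeP E]] := @mean_rV R n p r (fun v => y v 0 k) z w _ Bz Bw.
        by move=> i v Bv; exact: smooth_derivable (syB k) Bv.
      exists (fun i => jac y (ze i) i k); split; last first.
        by rewrite E; apply: eq_bigr => i _; rewrite mxE.
      move=> i; apply: (sP (ze i) _ (i, k)).
      rewrite ball_rVE; apply: (le_lt_trans (zeP i).2).
      by apply: (le_lt_trans wz); rewrite mulrC -ltr_pdivlMr.
    have [M MP] := choice Hm.
    have Ek k : h * (a == k)%:R = \sum_i M k i * (w 0 i - z 0 i).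
      by rewrite -(MP k).2 yw yz /q' !mxE eqxx /= addrK eq_sym.
    have JQ i : \sum_k jac y z i k * Q k j = (i == j)%:R.
      have /matrixP/(_ i j) : jac y z *m Q = 1%:M by rewrite mulmxV// rdet.
      by rewrite !mxE.
    have E1 : w 0 j - z 0 j - h * Q a j =
       \sum_k \sum_i (jac y z i k - M k i) * (w 0 i - z 0 i) * Q k j.
      have -> : w 0 j - z 0 j = \sum_k \sum_i jac y z i k * (w 0 i - z 0 i) * Q k j.
        rewrite exchange_big /=.
        under eq_bigr do (under eq_bigr do rewrite mulrAC; rewrite -mulr_suml JQ).
        by rewrite (bigD1 j)//= eqxx mul1r big1 ?addr0// => i /negbTE ->; rewrite mul0r.
      have -> : h * Q a j = \sum_k \sum_i M k i * (w 0 i - z 0 i) * Q k j.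
        under eq_bigr do rewrite -mulr_suml -Ek.
        rewrite (bigD1 a)//= eqxx mulr1 big1 ?addr0// => i.
        by rewrite eq_sym => /negbTE ->; rewrite mulr0 mul0r.
      rewrite -sumrB; apply: eq_bigr => k _; rewrite -sumrB.
      by apply: eq_bigr => i _; rewrite !mulrBl.
    have B1 : `|w 0 j - z 0 j - h * Q a j| <= `|h| * e.
      rewrite E1; apply: (le_trans (ler_norm_sum _ _ _)).
      apply: (@le_trans _ _ (\sum_k (n%:R * (d * (2 * `|h|)) * `|Q k j|))).
        apply: ler_sum => k _; apply: (le_trans (ler_norm_sum _ _ _)).
        rewrite -mulrA mulr_natl -[X in _ *+ X]card_ord -sumr_const.
        apply: ler_sum => i _; rewrite normrM ler_wpM2r// normrM.
        apply: ler_pM => //; first by apply: ltW; exact: (MP k).1.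
        by apply: le_trans wz; have := rV_coord_le (w - z) i; rewrite !mxE.
      rewrite -mulr_sumr -/cQ.
      have -> : n%:R * (d * (2 * `|h|)) * cQ = `|h| * (d * (2 * n%:R * cQ)) by ring.
      rewrite ler_wpM2l//; apply: (@le_trans _ _ (d * (2 * n%:R * cQ + 1))).
        by rewrite ler_wpM2l ?lerDl// ltW.
      by rewrite /d divfK// gt_eqF.
    have -> : Q a j - h^-1 *: (w 0 j - z 0 j) = - (h^-1 * (w 0 j - z 0 j - h * Q a j)).
      move: (w 0 j - z 0 j) (Q a j) => u1 u2.
      by rewrite /GRing.scale /= mulrBr mulKf// opprB.
    by rewrite normrN normrM normfV ler_pdivrMl ?normr_gt0.
  by split; [apply/cvg_ex; eexists; exact: L|apply/cvg_lim => //; exact: L].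
split=> //; last by move=> z; rewrite inE => Bz; rewrite xy.
move=> j; apply: (@smooth_system R n (y @` B) 'I_n (fun j q => x q 0 j)).
- by move=> i q Yq; exact: (continuous_comp (cx q Yq) (@coord_continuous _ _ _ 0 i (x q))).
- by move=> i k q Yq; have [] := dx q k i Yq.
move=> m cm i k.
have sQ : smooth_mx B (fun z => invmx (jac y z)).
  by apply: smooth_invmx => //; exact: smooth_jac.
refine (eq_Ck oyB _ (_ : Ck (y @` B) m (fun q => invmx (jac y (x q)) k i))).
  by move=> q /set_mem Yq; have [_ <-] := dx q k i Yq.
apply: (@Ck_comp R n n (y @` B) B m (fun z => invmx (jac y z) k i) x) => //.
by move=> q /xP[].
Unshelve. all: by end_near. Qed.

End InverseFunction.

(** * The curvature tensor *)

Section MatrixDerivative.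
Context {R : realType} {n : nat}.
Implicit Types (U : set 'rV[R]_n) (x : 'rV[R]_n).

Definition dmx (a b : nat) (k : 'I_n) (A : 'rV[R]_n -> 'M[R]_(a, b)) x : 'M[R]_(a, b) :=
  \matrix_(i, j) partial k (fun z => A z i j) x.

Lemma smooth_dmx (a b : nat) U k (A : 'rV[R]_n -> 'M[R]_(a, b)) : open U ->
  smooth_mx U A -> smooth_mx U (dmx k A).
Proof.
move=> oU sA i j; refine (eq_smooth oU _ (smooth_partial k (sA i j))).
by move=> x _; rewrite mxE.
Qed.

Lemma eq_dmx (a b : nat) U k (A B : 'rV[R]_n -> 'M[R]_(a, b)) x : open U -> U x ->
  {in U, A =1 B} -> dmx k A x = dmx k B x.
Proof.
move=> oU Ux AB; apply/matrixP => i j; rewrite !mxE.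
by apply: (eq_partial k oU Ux) => z Uz; rewrite AB.
Qed.

Lemma dmx_cst (a b : nat) k (A : 'M[R]_(a, b)) x : dmx k (fun=> A) x = 0.
Proof. by apply/matrixP => i j; rewrite !mxE partial_cst. Qed.

Lemma dmxB (a b : nat) U k (A B : 'rV[R]_n -> 'M[R]_(a, b)) x :
  smooth_mx U A -> smooth_mx U B -> U x ->
  dmx k (fun z => A z - B z) x = dmx k A x - dmx k B x.
Proof.
move=> sA sB Ux; apply/matrixP => i j; rewrite !mxE.
rewrite -(partialB k (sA i j) (sB i j) Ux).
by congr (partial k _ x); apply/funext => z; rewrite !mxE.
Qed.

Lemma dmxM (a b c : nat) U k (A : 'rV[R]_n -> 'M[R]_(a, b))
    (B : 'rV[R]_n -> 'M[R]_(b, c)) x : open U ->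
  smooth_mx U A -> smooth_mx U B -> U x ->
  dmx k (fun z => A z *m B z) x = dmx k A x *m B x + A x *m dmx k B x.
Proof.
move=> oU sA sB Ux; apply/matrixP => i j; rewrite !mxE -big_split /=.
have -> : (fun z => (A z *m B z) i j) = (fun z => \sum_d A z i d * B z d j).
  by apply/funext => z; rewrite mxE.
rewrite (partial_sum k _ oU _ Ux); last by move=> d; apply: smoothM.
by apply: eq_bigr => d _; rewrite !mxE (partialM k (sA i d) (sB d j) Ux).
Qed.

Lemma dmx_mull (a b c : nat) U k (A : 'M[R]_(a, b)) (B : 'rV[R]_n -> 'M[R]_(b, c)) x :
  open U -> smooth_mx U B -> U x ->
  dmx k (fun z => A *m B z) x = A *m dmx k B x.
Proof.
by move=> oU sB Ux; rewrite (dmxM k oU (@smooth_mx_cst R n _ _ U A) sB Ux) dmx_cst mul0mx add0r.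
Qed.

Lemma dmx_tr (a b : nat) k (A : 'rV[R]_n -> 'M[R]_(a, b)) x :
  dmx k (fun z => (A z)^T) x = (dmx k A x)^T.
Proof.
apply/matrixP => i j; rewrite !mxE; congr (partial k _ x).
by apply/funext => z; rewrite mxE.
Qed.

Lemma dmxC (a b : nat) U k l (A : 'rV[R]_n -> 'M[R]_(a, b)) x : open U ->
  smooth_mx U A -> U x -> dmx k (dmx l A) x = dmx l (dmx k A) x.
Proof.
move=> oU sA Ux; apply/matrixP => i j; rewrite [LHS]mxE [RHS]mxE.
have E m : (fun z => dmx m A z i j) = partial m (fun z => A z i j).
  by apply/funext => z; rewrite mxE.
rewrite (E k) (E l).
exact: (@partialC R n U _ x k l oU (sA i j) Ux).
Qed.

End MatrixDerivative.

Section Curvature.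
Context {R : realType} {n : nat}.
Implicit Types (U : set 'rV[R]_n) (x : 'rV[R]_n) (g : 'rV[R]_n -> 'M[R]_n).
Implicit Type Gam : 'I_n -> 'I_n -> 'I_n -> 'rV[R]_n -> R.

(** The upper index is the row index, so covectors are rows multiplied on the left and [Th] is
    parallel when [dmx k Th = Th *m conn Gam k]. In [low] the row index is the index after the comma
    of the lowered symbol. *)
Definition conn Gam (k : 'I_n) x : 'M[R]_n := \matrix_(s, j) Gam s j k x.

Definition low g (k : 'I_n) x : 'M[R]_n := \matrix_(i, j) Gamma_low g j k i x.

(** The uniqueness half of the Levi-Civita argument, for lowered symbols only; it is insensitive to
    degeneracy of [g]. *)
Lemma koszul g x (G : 'I_n -> 'I_n -> 'I_n -> R) :
  (forall i j k, G i j k = G i k j) ->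
  (forall i j k, G i j k + G j i k = partial k (fun z => g z i j) x) ->
  forall i j k, Gamma_low g j k i x = G i j k.
Proof.
move=> Gs GE i j k; rewrite /Gamma_low -(GE k i j) -(GE j i k) -(GE j k i).
rewrite (Gs k i j) (Gs i k j) (Gs j i k).
by field.
Qed.

Section Solution.
Variables (U : set 'rV[R]_n) (g : 'rV[R]_n -> 'M[R]_n).
Variable Gam : 'I_n -> 'I_n -> 'I_n -> 'rV[R]_n -> R.
Hypothesis oU : open U.
Hypothesis hg : smooth_symmetric_form U g.
Hypothesis hGam : Gamma_solution U g Gam.

Lemma form_tr x : U x -> (g x)^T = g x.
Proof. by move=> Ux; apply/matrixP => i j; rewrite mxE hg.2. Qed.

Lemma smooth_conn k : smooth_mx U (conn Gam k).
Proof.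
have [sG _ _] := hGam; move=> i j; refine (eq_smooth oU _ (sG i j k)).
by move=> x _; rewrite mxE.
Qed.

Lemma form_conn k x : U x -> g x *m conn Gam k x = low g k x.
Proof.
have [_ Gs GE] := hGam; move=> Ux; apply/matrixP => i j; rewrite mxE [RHS]mxE.
pose G i j k := \sum_s g x i s * Gam s j k x.
rewrite (@koszul g x G) => [||i' j' k'].
- by apply: eq_bigr => s _; rewrite mxE.
- by move=> i' j' k'; apply: eq_bigr => s _; rewrite Gs.
rewrite -GE// -big_split; apply: eq_bigr => s _.
by rewrite /= [g x i' s * _]mulrC [g x j' s * _]mulrC.
Qed.

Lemma dmx_form k x : U x ->
  dmx k g x = g x *m conn Gam k x + (conn Gam k x)^T *m g x.
Proof.
have [_ _ GE] := hGam; move=> Ux; apply/matrixP => i j; rewrite !mxE -GE//.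
rewrite big_split; congr (_ + _); apply: eq_bigr => s _; rewrite !mxE mulrC//.
by rewrite mulrC hg.2.
Qed.

Definition curv (k l : 'I_n) x := dmx k (conn Gam l) x - dmx l (conn Gam k) x +
  (conn Gam k x *m conn Gam l x - conn Gam l x *m conn Gam k x).

Lemma RtensorE i j k l x : U x -> Rtensor g Gam i j k l x = (g x *m curv k l x) i j.
Proof.
have [_ Gs _] := hGam; move=> Ux; rewrite /Rtensor [RHS]mxE.
apply: eq_bigr => s _; congr (_ * _); rewrite !mxE.
have E m : (fun z => conn Gam m z s j) = Gam s j m by apply/funext => z; rewrite mxE.
rewrite !E; congr (_ + _); rewrite sumrB; congr (_ - _); apply: eq_bigr => a _;
  by rewrite !mxE Gs// ?[Gam a l j x]Gs// ?[Gam a j l x]Gs.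
Qed.

(** The matrices [X] are any solution at the single point [x], with no smoothness: they may come
    from another connection, or from one known only locally. Replacing the connection by [X] is
    harmless because [(low g m x)^T] has [g x] as a right factor. *)
Lemma Rtensor_low (X : 'I_n -> 'M[R]_n) i j k l x : U x ->
  (forall m, g x *m X m = low g m x) ->
  Rtensor g Gam i j k l x =
  (dmx k (low g l) x - dmx l (low g k) x
   - ((low g k x)^T *m X l - (low g l x)^T *m X k)) i j.
Proof.
move=> Ux gX; rewrite RtensorE//; congr (fun_of_matrix _ i j).
have dlow m m' : dmx m (low g m') x =
    dmx m g x *m conn Gam m' x + g x *m dmx m (conn Gam m') x.
  rewrite -(dmxM m oU _ (smooth_conn m') Ux); last exact: hg.1.
  by apply: (eq_dmx m oU Ux) => z /set_mem Uz; rewrite form_conn.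
have lowX m m' : (low g m x)^T *m X m' = (conn Gam m x)^T *m g x *m conn Gam m' x.
  by rewrite -(form_conn m Ux) trmx_mul (form_tr Ux) -!mulmxA gX (form_conn m' Ux).
rewrite !dlow !lowX !dmx_form// /curv.
rewrite !mulmxDl !mulmxDr !mulmxN !mulmxA.
move: (g x *m dmx k _ x) (g x *m dmx l _ x) => a1 a2.
move: (g x *m conn Gam k x *m conn Gam l x) (g x *m conn Gam l x *m conn Gam k x) => a3 a4.
move: (_ *m _ *m _) (_ *m _ *m _) => a5 a6.
by apply/matrixP => i' j'; rewrite !mxE; ring.
Qed.

End Solution.

(** Both tensors are evaluated with the same [X], the matrices of the first solution. *)
Lemma Rtensor_independent U g Gam Gam' i j k l x :
  open U -> smooth_symmetric_form U g ->
  Gamma_solution U g Gam -> Gamma_solution U g Gam' -> U x ->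
  Rtensor g Gam i j k l x = Rtensor g Gam' i j k l x.
Proof.
move=> oU hg hGam hGam' Ux.
have gX m : g x *m conn Gam m x = low g m x by exact: form_conn hGam _ _ Ux.
rewrite (Rtensor_low oU hg hGam i j k l Ux gX).
by rewrite (Rtensor_low oU hg hGam' i j k l Ux gX).
Qed.

Lemma componentE g (x : 'rV[R]_n -> 'rV[R]_n) i j q :
  component g x i j q = (jac x q *m g (x q) *m (jac x q)^T) i j.
Proof.
rewrite /component -mulmxA mxE; apply: eq_bigr => r _.
rewrite !mxE mulr_sumr; apply: eq_bigr => s _; rewrite !mxE.
by rewrite [g _ _ _ * _]mulrC mulrA.
Qed.

(** With [g = J *m c *m J^T] and symmetric second derivatives of [y], the lowered symbols are
    [J *m c *m (dmx m J)^T]. In the curvature formula the second derivatives of [J] cancel by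
    symmetry and the products of first derivatives cancel against the quadratic terms. *)
Lemma flat_Rtensor U g Gam V (y x : 'rV[R]_n -> 'rV[R]_n) i j k l (z : 'rV[R]_n) :
  open U -> smooth_symmetric_form U g -> Gamma_solution U g Gam ->
  V `<=` U -> flat g V y x -> V z -> Rtensor g Gam i j k l z = 0.
Proof.
move=> oU hg hGam VU [hyx [c0 hc]] Vz.
have [oV oyV sy sx yx] := hyx.
have Uz := VU _ Vz.
pose c : 'M[R]_n := \matrix_(a, b) c0 a b.
pose J := jac y.
have sJ : smooth_mx V J by exact: smooth_jac.
have JK w : V w -> J w *m jac x (y w) = 1%:M by exact: coordinates_jac.
have KJ w : V w -> jac x (y w) *m J w = 1%:M by move=> Vw; apply: mulmx1C; exact: JK.
have cE w : V w -> c = jac x (y w) *m g w *m (jac x (y w))^T.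
  move=> Vw; apply/matrixP => a b; rewrite mxE -(hc a b (y w)); last by exists w.
  by rewrite componentE yx ?inE.
have gE w : V w -> g w = J w *m c *m (J w)^T.
  move=> Vw; rewrite (cE w Vw) !mulmxA JK// mul1mx -mulmxA -trmx_mul JK//.
  by rewrite trmx1 mulmx1.
have cT : c^T = c.
  by rewrite (cE z Vz) !trmx_mul trmxK (form_tr hg Uz) mulmxA.
have sc : smooth_mx V (fun=> c) by exact: smooth_mx_cst.
have sJT : smooth_mx V (fun w => (J w)^T) by exact: smooth_mx_tr.
have sJc : smooth_mx V (fun w => J w *m c) by exact: smooth_mxM.
have dJ m w : V w -> dmx m (fun w => J w *m c) w = dmx m J w *m c.
  by move=> Vw; rewrite (dmxM m oV sJ sc Vw) dmx_cst mulmx0 addr0.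
have dg m w : V w -> dmx m g w = dmx m J w *m c *m (J w)^T + J w *m c *m (dmx m J w)^T.
  move=> Vw; rewrite (@eq_dmx R n n n V m g (fun w => J w *m c *m (J w)^T) w oV Vw).
    by rewrite (dmxM m oV sJc sJT Vw) dJ// dmx_tr.
  by move=> v /set_mem Vv; exact: gE.
have ddy a m w b : V w -> dmx m J w a b = dmx a J w m b.
  move=> Vw; rewrite [LHS]mxE [RHS]mxE.
  have E d : (fun v => J v d b) = partial d (fun v => y v 0 b).
    by apply/funext => v; rewrite mxE.
  rewrite (E m) (E a).
  exact: (@partialC R n V _ w m a oV (sy b) Vw).
have lowE m w : V w -> low g m w = J w *m c *m (dmx m J w)^T.
  move=> Vw; apply/matrixP => a b; rewrite mxE.
  apply: (@koszul g w (fun a b m => (J w *m c *m (dmx m J w)^T) a b)) => [a' b' m'|a' b' m'].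
    rewrite [LHS]mxE [RHS]mxE; apply: eq_bigr => d _; congr (_ * _).
    by rewrite [LHS]mxE [RHS]mxE; exact: ddy.
  have := dg m' w Vw; move/matrixP/(_ a' b'); rewrite [LHS]mxE => ->.
  rewrite [RHS]mxE addrC; congr (_ + _).
  by rewrite -[dmx m' J w *m c *m _]trmxK [RHS]mxE !trmx_mul trmxK cT mulmxA.
(* The connection that is trivial in the coordinates [y], written in the original coordinates at
   [z]. *)
pose X m := (jac x (y z))^T *m (dmx m J z)^T.
have gX m : g z *m X m = low g m z.
  rewrite lowE// gE// /X -!mulmxA; congr (_ *m (_ *m _)).
  by rewrite mulmxA -trmx_mul KJ// trmx1 mul1mx.
rewrite (Rtensor_low oU hg hGam i j k l Uz gX).
have dlow a b : dmx a (low g b) z =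
   dmx a J z *m c *m (dmx b J z)^T + J z *m c *m (dmx a (dmx b J) z)^T.
  rewrite (@eq_dmx R n n n V a (low g b) (fun w => J w *m c *m (dmx b J w)^T) z oV Vz).
    rewrite (dmxM a oV sJc (smooth_mx_tr oV (smooth_dmx b oV sJ)) Vz).
    by rewrite dJ// dmx_tr.
  by move=> w /set_mem Vw; exact: lowE.
have lowX a b : (low g a z)^T *m X b = dmx a J z *m c *m (dmx b J z)^T.
  rewrite lowE// !trmx_mul trmxK cT /X -!mulmxA; congr (_ *m (_ *m _)).
  by rewrite mulmxA -trmx_mul KJ// trmx1 mul1mx.
rewrite !dlow !lowX (dmxC k l oV sJ Vz).
have cancel (P1 P2 P3 : 'M[R]_n) : P1 + P3 - (P2 + P3) - (P1 - P2) = 0.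
  by rewrite opprD addrACA subrr addr0 subrr.
by rewrite cancel mxE.
Qed.

End Curvature.

(** * A global connection *)

Section Frame.
Context {R : realType} {n : nat}.
Implicit Types (U : set 'rV[R]_n) (x p : 'rV[R]_n) (g : 'rV[R]_n -> 'M[R]_n).

(** If [v] is killed by the Gram matrix, then [v *m A] has Euclidean norm zero. *)
Lemma gram_unitmx (a b : nat) (A : 'M[R]_(a, b)) : row_free A -> A *m A^T \in unitmx.
Proof.
move=> fA; rewrite -row_free_unit; apply: inj_row_free => v vA.
have w0 : (v *m A) *m (v *m A)^T = 0.
  by rewrite trmx_mul mulmxA -(mulmxA v) vA mul0mx.
have : v *m A = 0.
  apply/rowP => j; rewrite [RHS]mxE.
  have := w0; move: (v *m A) => w /matrixP/(_ 0 0); rewrite !mxE => /eqP.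
  under eq_bigr do rewrite mxE.
  rewrite psumr_eq0; last by move=> i _; rewrite -expr2 sqr_ge0.
  by move=> /allP/(_ j); rewrite mem_index_enum => /(_ isT); rewrite mulf_eq0 orbb => /eqP.
by move=> H; apply: (row_free_inj fA); rewrite H mul0mx.
Qed.

(* Constant rank keeps a frame of the row space of [g] at [p] a frame nearby. *)
Lemma local_frame U g p : open U -> U p -> smooth_mx U g -> constant_rank U g ->
  exists (N : nat) (S : 'M[R]_(N, n)) (r : R),
    [/\ 0 < r, ball p r `<=` U,
      forall x, ball p r x -> S *m g x *m (S *m g x)^T \in unitmx &
      forall x, ball p r x -> (g x <= S *m g x)%MS].
Proof.
move=> oU Up sg [rk hrk].
pose N := \rank (g p).
have [S SE] : exists S : 'M[R]_(N, n), row_base (g p) = S *m g p.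
  by apply/submxP; rewrite eq_row_base.
pose A x := S *m g x.
have sA : smooth_mx U A by apply: smooth_mxM => //; exact: smooth_mx_cst.
have sAA : smooth_mx U (fun x => A x *m (A x)^T).
  by apply: smooth_mxM => //; exact: smooth_mx_tr.
have uAp : A p *m (A p)^T \in unitmx.
  by rewrite /A -SE; apply: gram_unitmx; exact: row_base_free.
have d0 : 0 < `|\det (A p *m (A p)^T)|.
  by rewrite normr_gt0; move: uAp; rewrite unitmxE unitfE.
have N1 : \forall x \near p,
   `|\det (A p *m (A p)^T) - \det (A x *m (A x)^T)| < `|\det (A p *m (A p)^T)|.
  by move: (smooth_continuous (smooth_det oU sAA) Up) => /cvgrPdist_lt; apply.
have nU : nbhs p U by exact: open_nbhs_nbhs.
have : nbhs p (U `&` [set x |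
   `|\det (A p *m (A p)^T) - \det (A x *m (A x)^T)| < `|\det (A p *m (A p)^T)| ]).
  exact: filterI nU N1.
move=> /nbhs_ballP[r /= r0 rP].
have uA x : ball p r x -> A x *m (A x)^T \in unitmx.
  move=> /rP[_ /= +]; rewrite unitmxE unitfE.
  by apply: contraTneq => ->; rewrite subr0 ltxx.
exists N, S, r; split=> //; first by move=> x /rP[].
move=> x rx; have [Ux _] := rP _ rx.
have fA : row_free (A x).
  rewrite /row_free eqn_leq rank_leq_row /=.
  by rewrite -[X in (X <= _)%N](mxrank_unit (uA x rx)) mxrankM_maxl.
have sAg : (A x <= g x)%MS by exact: submxMl.
(* The invertible Gram matrix gives [A x] full row rank [N], and constant rank makes this the rank
   of [g x]: the inclusion of row spaces is an equality. *)
rewrite -(geq_leqif (mxrank_leqif_sup sAg)).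
by move/eqP: fA; rewrite -/(A x) => ->; rewrite /N !hrk.
Qed.

Variables (U : set 'rV[R]_n) (g : 'rV[R]_n -> 'M[R]_n).
Hypothesis oU : open U.
Hypothesis hg : smooth_symmetric_form U g.
Hypothesis hrank : constant_rank U g.
Hypothesis hrad : forall x, U x -> forall (i j : 'I_n) (v : 'rV[R]_n),
  radical g x v -> \sum_s Gamma_low g i j s x * v 0 s = 0.

Let gT x : U x -> (g x)^T = g x. Proof. exact: form_tr. Qed.
Let sg : smooth_mx U g. Proof. exact: hg.1. Qed.

Definition row_low (j k : 'I_n) x : 'rV[R]_n := \row_i Gamma_low g j k i x.

(* The solution of [X *m g = row_low j k] lying in the row space of [g]. It is
   unique, so its smoothness can be read off in a local frame. *)
Definition row_christoffel (j k : 'I_n) x : 'rV[R]_n :=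
  row_low j k x *m pinvmx (g x *m g x) *m g x.

Definition christoffel (s j k : 'I_n) x : R := row_christoffel j k x 0 s.

(** By symmetry of [g] the columns of [cokermx (g x)] are radical vectors, so the hypothesis on the
    radical says exactly that the lowered symbols lie in the row space of [g x]. *)
Lemma row_low_sub j k x : U x -> (row_low j k x <= g x)%MS.
Proof.
move=> Ux; rewrite submxE; apply/eqP/rowP => i; rewrite !mxE.
pose v : 'rV[R]_n := (col i (cokermx (g x)))^T.
have rv : radical g x v.
  rewrite /radical /= /v -(gT Ux) -trmx_mul (gT Ux) colE mulmxA mulmx_coker.
  by rewrite mul0mx trmx0.
by rewrite -[RHS](hrad Ux j k rv); apply: eq_bigr => s _; rewrite !mxE.
Qed.

Lemma Gamma_lowC i j s x : U x -> Gamma_low g i j s x = Gamma_low g j i s x.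
Proof.
move=> Ux; rewrite /Gamma_low; congr (_ * (_ - _)); first exact: addrC.
by apply: (eq_partial s oU Ux) => z /set_mem Uz; exact: hg.2.
Qed.

Section Local.
Variables (N : nat) (S : 'M[R]_(N, n)) (p : 'rV[R]_n) (r : R).
Hypothesis rU : ball p r `<=` U.
Hypothesis uA : forall x, ball p r x -> S *m g x *m (S *m g x)^T \in unitmx.
Hypothesis gA : forall x, ball p r x -> (g x <= S *m g x)%MS.

Let A x := S *m g x.
(** If [row_low j k x = w *m g x], this is [w] times the orthogonal projector onto the span of the
    frame [A x]. Only the inverse of an invertible matrix occurs, so smoothness is visible. *)
Let local_row j k x := row_low j k x *m S^T *m invmx (A x *m (A x)^T) *m A x.

Let local_row_form j k x : ball p r x -> local_row j k x *m g x = row_low j k x.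
Proof.
move=> rx; have Ux := rU rx.
have [D DE] := submxP (gA rx); have [w wE] := submxP (row_low_sub j k Ux).
have E : g x = (A x)^T *m D^T by rewrite -trmx_mul -DE gT.
have AT : (A x)^T = g x *m S^T by rewrite /A trmx_mul gT.
rewrite /local_row E mulmxA.
rewrite -(mulmxA _ (A x)) -(mulmxA _ (invmx _)) mulVmx ?uA// mulmx1.
by rewrite wE -(mulmxA w) -AT -(mulmxA w) -E.
Qed.

(** Both rows solve the equation and lie in the row space of [g x]. Their difference [c *m A x] is
    killed by [g x], hence by [(A x)^T], and the Gram matrix forces [c = 0]. The inclusion [sub] is
    what makes the pseudo-inverse a genuine solution. *)
Let local_christoffel j k x : ball p r x -> row_christoffel j k x = local_row j k x.
Proof.
move=> rx; have Ux := rU rx; have lE := local_row_form j k rx.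
have sub : (row_low j k x <= g x *m g x)%MS.
  have -> : row_low j k x =
      row_low j k x *m S^T *m invmx (A x *m (A x)^T) *m S *m (g x *m g x).
    by rewrite -[LHS]lE /local_row /A !mulmxA.
  exact: submxMl.
have cE : row_christoffel j k x *m g x = row_low j k x.
  by rewrite /row_christoffel -mulmxA mulmxKpV.
have [c cA] : exists c, row_christoffel j k x - local_row j k x = c *m A x.
  apply/submxP; apply: addmx_sub; last by rewrite eqmx_opp; exact: submxMl.
  by apply: submx_trans (gA rx); exact: submxMl.
apply/eqP; rewrite -subr_eq0 cA; apply/eqP.
have : c *m (A x *m (A x)^T) = 0.
  by rewrite mulmxA -cA /A trmx_mul gT// mulmxA mulmxBl cE lE subrr mul0mx.
by move/(congr1 (mulmx^~ (invmx (A x *m (A x)^T)))); rewrite mulmxK ?uA// mul0mx => ->;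
  rewrite mul0mx.
Qed.

Lemma christoffel_form j k x : ball p r x ->
  row_christoffel j k x *m g x = row_low j k x.
Proof. by move=> rx; rewrite local_christoffel// local_row_form. Qed.

Lemma smooth_christoffel_ball s j k : smooth (ball p r) (christoffel s j k).
Proof.
have oB : open (ball p r) by exact: ball_open.
have sgB : smooth_mx (ball p r) g by move=> a b; exact: smooth_sub rU (sg a b).
have sA : smooth_mx (ball p r) A by apply: smooth_mxM => //; exact: smooth_mx_cst.
have slow : smooth_mx (ball p r) (row_low j k).
  move=> a b; refine (eq_smooth oB _ (_ : smooth _ (Gamma_low g j k b))).
    by move=> x _; rewrite mxE.
  apply: smoothM => //; first exact: smooth_cst.
  apply: smoothB => //; last exact: smooth_partial.
  by apply: smoothD => //; exact: smooth_partial.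
have sL : smooth_mx (ball p r) (local_row j k).
  apply: smooth_mxM => //; apply: smooth_mxM => //.
    by apply: smooth_mxM => //; exact: smooth_mx_cst.
  apply: (smooth_invmx oB uA).
  by apply: smooth_mxM => //; exact: smooth_mx_tr.
refine (eq_smooth oB _ (sL 0 s)) => x /set_mem rx.
by rewrite /christoffel local_christoffel.
Qed.

End Local.

Lemma christoffel_solution : Gamma_solution U g christoffel.
Proof.
have form j k x : U x -> row_christoffel j k x *m g x = row_low j k x.
  move=> Ux; have [N [S [r [r0 rU uA gA]]]] := local_frame oU Ux sg hrank.
  exact: (christoffel_form rU uA gA j k (ballxx x r0)).
split.
- move=> s j k; apply: smooth_locally => x Ux.
  have [N [S [r [r0 rU uA gA]]]] := local_frame oU Ux sg hrank.
  exists (ball x r); first exact: ballxx.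
  exact: (smooth_christoffel_ball rU uA gA).
- move=> s j k x Ux; rewrite /christoffel /row_christoffel.
  have -> // : row_low j k x = row_low k j x.
  by apply/rowP => i; rewrite [LHS]mxE [RHS]mxE Gamma_lowC.
move=> i j k x Ux.
have E a b c : \sum_s christoffel s a b x * g x c s = Gamma_low g a b c x.
  have /rowP/(_ c) := form a b x Ux; rewrite !mxE => <-.
  by apply: eq_bigr => s _; rewrite hg.2.
have C a b c : partial a (fun z => g z b c) x = partial a (fun z => g z c b) x.
  by apply: (eq_partial a oU Ux) => z /set_mem Uz; exact: hg.2.
rewrite big_split /= !E /Gamma_low (C j i k) (C i j k) (C k j i).
by field.
Qed.

End Frame.

(** * Flat coordinates *)

Section FlatCoordinates.
Context {R : realType} {n : nat}.
Implicit Types (x p z : 'rV[R]_n).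

(** The fundamental matrix: its rows are the solutions starting at the unit vectors. *)
Lemma linear_system_mx (N : nat) (B : set 'rV[R]_n) p (W : 'I_n -> 'rV[R]_n -> 'M[R]_N) :
  open B -> B p -> (forall k, smooth_mx B (W k)) ->
  (forall j k x, B x ->
    dmx j (W k) x + W j x *m W k x = dmx k (W j) x + W k x *m W j x) ->
  exists (r : R) (u : 'rV[R]_n -> 'M[R]_N),
    [/\ 0 < r, ball p r `<=` B, smooth_mx (ball p r) u, u p = 1%:M &
      forall k x, ball p r x -> dmx k u x = u x *m W k x].
Proof.
move=> oB Bp sW fW.
have [||r [r0 rB sol]] := @linear_system R n N B p (fun k c b x => W k x c b) oB Bp.
- by move=> k c b; exact: sW.
- move=> j k c b x Bx; have := fW j k x Bx => /matrixP/(_ c b).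
  rewrite [LHS]mxE [RHS]mxE => E; move: E.
  by rewrite [dmx _ _ _ _ _]mxE [in RHS]mxE [(_ *m _) c b]mxE => ->; rewrite [(_ *m _) c b]mxE.
have [v vP] := choice (fun a : 'I_N => sol (fun b => (a == b)%:R)).
exists r, (fun x => \matrix_(a, b) v a b x).
have E a b : (fun z => (\matrix_(a, b) v a b z) a b) = v a b.
  by apply/funext => z; rewrite mxE.
split=> //.
- by move=> a b; rewrite E; have [+ _ _] := vP a; exact.
- by apply/matrixP => a b; rewrite !mxE; have [_ + _] := vP a; exact.
move=> k x rx; apply/matrixP => a b; rewrite [LHS]mxE E [RHS]mxE.
have [_ _ ->//] := vP a.
by apply: eq_bigr => c _; rewrite mxE.
Qed.

(** The potentials of the closed forms [Th - Th p] have zero gradient at [p], so adding them to the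
    linear coordinates keeps the Jacobian matrix at [p] the identity. When [Th p *m Q = 1%:M], the
    formula gives [jac y x *m (Th p)^T = (Th x)^T]: the coframe has constant components in the
    coordinates [y]. *)
Lemma jac_potential (N : nat) p r (Th : 'rV[R]_n -> 'M[R]_(N, n)) (Q : 'M[R]_(n, N)) :
  0 < r -> smooth_mx (ball p r) Th ->
  (forall a j k x, ball p r x -> dmx k Th x a j = dmx j Th x a k) ->
  exists y : 'rV[R]_n -> 'rV[R]_n, smooth_map (ball p r) y /\
    forall x, ball p r x -> jac y x = 1%:M + (Th x - Th p)^T *m Q^T.
Proof.
move=> r0 sT cT; set B := ball p r.
have oB : open B by exact: ball_open.
pose w a j x := Th x a j - Th p a j.
have sw a j : smooth B (w a j) by apply: smoothB => //; exact: smooth_cst.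
have pw a j k x : B x -> partial k (w a j) x = dmx k Th x a j.
  move=> Bx; rewrite (partialB k (sT a j) (smooth_cst B (Th p a j)) Bx) partial_cst subr0.
  by rewrite [RHS]mxE.
pose Y a := primitive p (w a).
have sY a : smooth B (Y a) by exact: smooth_primitive.
have dY a k x : B x -> partial k (Y a) x = w a k x.
  move=> Bx; apply: (primitive_closed (r := r)) => // j' k' z Bz.
  by rewrite !pw// cT.
have sQ a j : smooth B (fun x => Q j a * Y a x).
  by apply: smoothM => //; exact: smooth_cst.
have sS j : smooth B (fun x => \sum_a Q j a * Y a x) by apply: smooth_sum.
pose y (x : 'rV[R]_n) : 'rV[R]_n := \row_j (x 0 j + \sum_a Q j a * Y a x).
have yE j : (fun x => y x 0 j) = (fun x => x 0 j + \sum_a Q j a * Y a x).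
  by apply/funext => x; rewrite mxE.
exists y; split=> [j|x Bx].
  by rewrite yE; apply: smoothD => //; exact: smooth_coord.
apply/matrixP => i j; rewrite [LHS]mxE yE.
rewrite (partialD i (smooth_coord (U := B) j) (sS j) Bx) partial_coord.
rewrite (partial_sum i _ oB (sQ^~ j) Bx).
rewrite [RHS]mxE [in RHS]mxE; congr (_ + _); rewrite [RHS]mxE.
apply: eq_bigr => a _; rewrite (partialMcst i (Q j a) (sY a) Bx) dY//.
by rewrite mulrC !mxE.
Qed.

Section Existence.
Variables (U : set 'rV[R]_n) (g : 'rV[R]_n -> 'M[R]_n).
Variable Gam : 'I_n -> 'I_n -> 'I_n -> 'rV[R]_n -> R.
Hypothesis oU : open U.
Hypothesis hg : smooth_symmetric_form U g.
Hypothesis hrank : constant_rank U g.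
Hypothesis hGam : Gamma_solution U g Gam.
Hypothesis hR : forall i j k l x, U x -> Rtensor g Gam i j k l x = 0.

Let G := conn Gam.
Let sg : smooth_mx U g. Proof. exact: hg.1. Qed.
Let sG k : smooth_mx U (G k). Proof. exact: smooth_conn oU hGam k. Qed.
Let gT x : U x -> (g x)^T = g x. Proof. exact: form_tr. Qed.

Let form_curv k l x : U x -> g x *m curv Gam k l x = 0.
Proof.
by move=> Ux; apply/matrixP => i j; rewrite -(RtensorE hGam)// hR// mxE.
Qed.

(* In the frame [S *m g] the connection restricted to the row space of [g] is
   an honest flat connection: the curvature only takes values in the radical. *)
Lemma parallel_coframe p : U p ->
  exists (N : nat) (r : R) (Th : 'rV[R]_n -> 'M[R]_(N, n)) (Q : 'M[R]_(n, N)),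
  [/\ 0 < r, ball p r `<=` U, smooth_mx (ball p r) Th,
    forall k x, ball p r x -> dmx k Th x = Th x *m G k x &
    Th p *m Q = 1%:M /\ g p *m Q *m Th p = g p].
Proof.
move=> Up; have [N [S [r [r0 rU uA gA]]]] := local_frame oU Up sg hrank.
pose B := ball p r; have oB : open B by exact: ball_open.
pose A x := S *m g x.
(* The Moore-Penrose inverse of the frame: a right inverse of [A x], while [P x *m A x] fixes every
   row in the row space of [g x]. *)
pose P x := (A x)^T *m invmx (A x *m (A x)^T).
have sAU : smooth_mx U A by apply: smooth_mxM => //; exact: smooth_mx_cst.
have sub (a b : nat) (M : 'rV[R]_n -> 'M[R]_(a, b)) : smooth_mx U M -> smooth_mx B M.
  by move=> sM i j; exact: smooth_sub rU (sM i j).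
have sA : smooth_mx B A by exact: sub.
have sP : smooth_mx B P.
  apply: smooth_mxM => //; first exact: smooth_mx_tr.
  by apply: (smooth_invmx oB uA); apply: smooth_mxM => //; exact: smooth_mx_tr.
have AP x : B x -> A x *m P x = 1%:M by move=> Bx; rewrite /P mulmxA mulmxV// uA.
have PA (m : nat) (M : 'M[R]_(m, n)) x : B x -> (M <= g x)%MS -> M *m P x *m A x = M.
  move=> Bx Mg; have [D ->] := submxP (submx_trans Mg (gA x Bx)).
  by rewrite -/(A x) -(mulmxA D) AP// mulmx1.
have dA k x : B x -> dmx k A x = A x *m G k x + S *m (G k x)^T *m g x.
  move=> Bx; have Ux := rU _ Bx.
  by rewrite (dmx_mull k S oU sg Ux) (dmx_form hg hGam k Ux) mulmxDr !mulmxA.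
have AK j k x : B x -> A x *m curv Gam j k x = 0.
  by move=> Bx; rewrite -mulmxA form_curv ?mulmx0//; exact: rU.
(* By compatibility of the connection with [g], the covariant derivative of the frame has its rows
   in the row space of [g x], so it can be expanded in the frame; [Om] collects the coefficients. *)
have OmAE k x : B x -> (A x *m G k x - dmx k A x) *m P x *m A x = A x *m G k x - dmx k A x.
  move=> Bx; apply: PA => //; rewrite dA// opprD addrA subrr add0r.
  by rewrite eqmx_opp; exact: submxMl.
have A_p : g p *m P p *m A p = g p by apply: PA => //; exact: ballxx.
clearbody P; move: A sA {sAU PA dA} AP AK OmAE A_p => A sA AP AK OmAE A_p.
pose Om k x := (A x *m G k x - dmx k A x) *m P x.
have sD k : smooth_mx B (fun x => A x *m G k x - dmx k A x).
  exact: (smooth_mxB oB (smooth_mxM oB sA (sub _ _ _ (sG k))) (smooth_dmx k oB sA)).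
have sOm k : smooth_mx B (Om k) by exact: (smooth_mxM oB (sD k) sP).
have OmA k x : B x -> Om k x *m A x = A x *m G k x - dmx k A x.
  by move=> Bx; exact: OmAE.
move: Om sOm OmA {OmAE} => Om sOm OmA.
have dAE k x : B x -> dmx k A x = A x *m G k x - Om k x *m A x.
  by move=> Bx; rewrite OmA// opprB addrCA subrr addr0.
have dOmA j k x : B x -> dmx j (Om k) x *m A x =
    (A x *m G j x *m G k x - Om j x *m A x *m G k x + A x *m dmx j (G k) x
     - dmx j (dmx k A) x) - (Om k x *m A x *m G j x - Om k x *m Om j x *m A x).
  move=> Bx.
  have H : dmx j (fun z => Om k z *m A z) x = dmx j (fun z => A z *m G k z - dmx k A z) x.
    by apply: (eq_dmx j oB Bx) => z /set_mem Bz; exact: OmA.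
  have sAG := smooth_mxM oB sA (sub _ _ _ (sG k)).
  have sdA := smooth_dmx k oB sA.
  move: H; rewrite (dmxM j oB (sOm k) sA Bx) (dmxB j sAG sdA Bx).
  rewrite (dmxM j oB sA (sub _ _ _ (sG k)) Bx) (dAE j x Bx).
  move=> H; rewrite -[LHS](addrK (Om k x *m (A x *m G j x - Om j x *m A x))) H.
  by rewrite mulmxBl mulmxBr !mulmxA.
have flat j k x : B x ->
    dmx j (Om k) x + Om j x *m Om k x = dmx k (Om j) x + Om k x *m Om j x.
  move=> Bx.
  (* Flatness is checked after multiplication by [A x], where it reduces to
     [A x *m curv Gam j k x = 0]; the right inverse [P x] then removes the factor. *)
  have H : (dmx j (Om k) x + Om j x *m Om k x) *m A x =
      (dmx k (Om j) x + Om k x *m Om j x) *m A x.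
    have key (a b c d e f dd h1 h2 : 'M[R]_(N, n)) : a - b + (c - d) = 0 ->
        c - e + a - dd - (f - h1) + h2 = d - f + b - dd - (e - h2) + h1.
      move/matrixP => E; apply/matrixP => i' j'; move: (E i' j'); rewrite !mxE; lra.
    rewrite !mulmxDl !dOmA// (dmxC k j oB sA Bx).
    have K := AK j k x Bx.
    rewrite /curv -/(G j) -/(G k) mulmxDr !mulmxBr !mulmxA in K.
    exact: key K.
  by rewrite -[LHS]mulmx1 -[RHS]mulmx1 -(AP x Bx) !mulmxA H.
have Bp : B p by exact: ballxx.
have [s [u [s0 sB su up du]]] := linear_system_mx oB Bp sOm flat.
(* A change of frame by the fundamental matrix of [Om]: the [Om] terms in the derivative cancel and
   the new frame is parallel. *)
pose Th x := u x *m A x.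
exists N, s, Th, (P p).
have os : open (ball p s) by exact: ball_open.
have sAs : smooth_mx (ball p s) A by move=> i j; exact: smooth_sub sB (sA i j).
split=> //.
- exact: subset_trans sB rU.
- exact: smooth_mxM.
- move=> k x sx; have Bx := sB _ sx.
  rewrite (dmxM k os su sAs sx) du// dAE// mulmxBr /Th !mulmxA.
  by rewrite addrCA subrr addr0.
by rewrite /Th up mul1mx AP.
Qed.

(** The difference [h] between [g] and the form with constant matrix [c] in the parallel coframe
    satisfies a linear homogeneous system and vanishes at [p], hence vanishes nearby. Since the
    coframe is constant in the coordinates [y], so is [g]. *)
Lemma flat_exists : flat_coordinates_exist U g.
Proof.
move=> p Up.
have [N [r [Th [Q [r0 rU sT dT [TQ gQT]]]]]] := parallel_coframe Up.
pose B := ball p r; have oB : open B by exact: ball_open.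
have Bp : B p by exact: ballxx.
have [_ Gs _] := hGam.
have cT a j k x : B x -> dmx k Th x a j = dmx j Th x a k.
  move=> Bx; rewrite !dT// [LHS]mxE [RHS]mxE; apply: eq_bigr => s _.
  by congr (_ * _); rewrite [LHS]mxE [RHS]mxE Gs//; exact: rU.
have [y [sy Jy]] := jac_potential Q r0 sT cT.
have Jp : jac y p = 1%:M by rewrite Jy// subrr trmx0 mul0mx addr0.
(* The matrix of [g p] in the coframe [Th p], read off with its right inverse [Q]. *)
pose c := Q^T *m g p *m Q.
pose h x := g x - (Th x)^T *m (c *m Th x).
have gTp : (g p)^T = g p by exact: gT.
have hp : h p = 0.
  have QTg : (Th p)^T *m Q^T *m g p = g p.
    by have := congr1 trmx gQT; rewrite !trmx_mul gTp mulmxA.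
  by rewrite /h /c !mulmxA QTg gQT subrr.
have sgB : smooth_mx B g by move=> i j; exact: smooth_sub rU (sg i j).
have scT : smooth_mx B (fun x => c *m Th x).
  by apply: smooth_mxM => //; exact: smooth_mx_cst.
have sTT := smooth_mx_tr oB sT.
have sTcT : smooth_mx B (fun x => (Th x)^T *m (c *m Th x)) by exact: smooth_mxM.
have sh : smooth_mx B h by exact: smooth_mxB.
have dh k x : B x -> dmx k h x = h x *m G k x + (G k x)^T *m h x.
  move=> Bx; rewrite (dmxB k sgB sTcT Bx) (dmx_form hg hGam k (rU _ Bx)).
  rewrite (dmxM k oB sTT scT Bx) dmx_tr (dmx_mull k c oB sT Bx) dT// trmx_mul.
  rewrite /h mulmxBl mulmxBr !mulmxA.
  by rewrite [X in _ - X]addrC opprD addrACA.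
have [|s [C [s0 C0 sB GC]]] := @locally_bounded R n B p ('I_n * 'I_n * 'I_n)%type
   (fun i x => G i.1.1 x i.1.2 i.2) oB Bp.
  move=> i; exact: smooth_continuous (sG _ _ _) Up.
(* The growth constant counts, for each entry of the derivative of [h], [n] summands with two
   products bounded by [C * M]. *)
have [||||t [t0 tB hz]] := @linear_system_zero R n ('I_n * 'I_n)%type (ball p s) p
   (fun i x => h x i.1 i.2) (n%:R * (2 * C)) (ball_open p s) (ballxx p s0).
- by move=> i; exact: smooth_sub sB (sh _ _).
- by move=> i; rewrite hp mxE.
- by rewrite !mulr_ge0.
- move=> x M sx hM [a b] k /=; have Bx := sB _ sx.
  have -> : partial k (fun z => h z a b) x = dmx k h x a b by rewrite mxE.
  have hM' i j : `|h x i j| <= M by exact: (hM (i, j)).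
  have GC' i j : `|G k x i j| <= C by exact: (GC (k, i, j)).
  rewrite dh// mxE [X in `|X + _|]mxE [X in `|_ + X|]mxE -big_split /=.
  apply: (le_trans (ler_norm_sum _ _ _)).
  rewrite -mulrA mulr_natl -[X in _ *+ X]card_ord -sumr_const.
  apply: ler_sum => i _; apply: (le_trans (ler_normD _ _)).
  rewrite !normrM -mulrA mulr_natl mulr2n; apply: lerD.
    by rewrite mulrC ler_pM.
  by rewrite [(G k x)^T a i]mxE ler_pM.
have tr : ball p t `<=` B by exact: subset_trans tB sB.
have syt : smooth_map (ball p t) y by move=> j; exact: smooth_sub tr (sy j).
have [V [x [Vp Vt hyx]]] := local_inverse (ball_open p t) (ballxx p t0) syt Jp.
exists V, y, x; split=> //; first by move=> z /Vt/tr; exact: rU.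
(* The normalisation of [y] at [p] makes the constant components those of [g p] itself. *)
split=> //; exists (fun i j => g p i j) => i j _ [z Vz <-].
have [_ _ _ _ yx] := hyx.
have tz := Vt _ Vz; have Bz := tr _ tz.
rewrite componentE yx ?inE//.
have JT : jac y z *m (Th p)^T = (Th z)^T.
  rewrite Jy// mulmxDl mul1mx -mulmxA -trmx_mul TQ trmx1 mulmx1 linearB /=.
  by rewrite addrCA subrr addr0.
have gz : g z = jac y z *m g p *m (jac y z)^T.
  have hz0 : h z = 0 by apply/matrixP => a b; rewrite [RHS]mxE; exact: (hz (a, b) z tz).
  have -> : g z = (Th z)^T *m (c *m Th z) by apply/eqP; rewrite -subr_eq0; apply/eqP.
  have -> : g p = (Th p)^T *m (c *m Th p) by apply/eqP; rewrite -subr_eq0; apply/eqP.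
  by rewrite -JT -[Th z]trmxK -JT trmx_mul trmxK !mulmxA.
have KJ : jac x (y z) *m jac y z = 1%:M.
  by apply: mulmx1C; exact: coordinates_jac hyx Vz.
rewrite gz !mulmxA KJ mul1mx -mulmxA -trmx_mul KJ trmx1 mulmx1//.
Qed.

End Existence.

End FlatCoordinates.

Theorem theorem2p2 (R : realType) (n : nat) (U : set 'rV[R]_n)
    (g : 'rV[R]_n -> 'M[R]_n)
    (hU : domain U)
    (hg : smooth_symmetric_form U g)
    (hrank : constant_rank U g)
    (hrad : forall x, U x -> forall (i j : 'I_n) (v : 'rV[R]_n),
        radical g x v -> \sum_s Gamma_low g i j s x * v 0 s = 0) :
  (forall Gam Gam' : 'I_n -> 'I_n -> 'I_n -> 'rV[R]_n -> R,
      Gamma_solution U g Gam -> Gamma_solution U g Gam' ->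
      forall (i j k l : 'I_n) (x : 'rV[R]_n), U x ->
        Rtensor g Gam i j k l x = Rtensor g Gam' i j k l x) /\
  (flat_coordinates_exist U g <->
   exists Gam : 'I_n -> 'I_n -> 'I_n -> 'rV[R]_n -> R,
     Gamma_solution U g Gam /\
     forall (i j k l : 'I_n) (x : 'rV[R]_n), U x ->
       Rtensor g Gam i j k l x = 0).
Proof.
have [oU _ _] := hU; split.
  by move=> Gam Gam' hGam hGam' i j k l x Ux; exact: (Rtensor_independent i j k l oU hg).
split=> [hflat|[Gam [hGam hR]]]; last exact: (flat_exists oU hg hrank hGam hR).
have hGam := christoffel_solution oU hg hrank hrad.
exists (christoffel g); split=> // i j k l p Up.
have [V [y [x [Vp VU hV]]]] := hflat p Up.
exact: (flat_Rtensor i j k l oU hg hGam VU hV Vp).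
Qed.
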